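(* Let $n,m,s,t\in\mathbb{N}$ and let $\lambda_1,\dots,\lambda_{s+t},\mu_1,\dots,\mu_{s+t}$ be indeterminates; write $\boldsymbol{\lambda}=(\lambda_1,\dots,\lambda_s)$, $\boldsymbol{\lambda}'=(\lambda_{s+1},\dots,\lambda_{s+t})$, and similarly $\boldsymbol{\mu},\boldsymbol{\mu}'$. For $\boldsymbol{r}=(r_1,\dots,r_{s+t})\in Z_{s+t,n}$ and $\boldsymbol{k}=(k_1,\dots,k_{s+t})\in Z_{s+t,m}$ put $S(\boldsymbol{r},\boldsymbol{k}):=\prod_{l=1}^{s+t}S^{\mathrm{sgn}}_{r_l,k_l}$ and $q(\boldsymbol{r},\boldsymbol{k}):=\sum_{l=s+1}^{s+t}(r_l+k_l)+t$. Then in $\mathscr{A}[\lambda_1,\dots,\lambda_{s+t},\mu_1,\dots,\mu_{s+t}]$, \[ \sum_{\substack{\boldsymbol{r}\in Z_{s+t,n}\\ \boldsymbol{k}\in Z_{s+t,m}}}(-1)^{q(\boldsymbol{r},\boldsymbol{k})}\Big(\prod_{l=1}^{s+t}\lambda_l^{r_l}\mu_l^{k_l}\Big) \sum_{(\boldsymbol{\alpha}_1,\ldots,\boldsymbol{\alpha}_{s+t})\in S(\boldsymbol{r},\boldsymbol{k})}\Big(\prod_{u=1}^t \mathrm{sgn}(\boldsymbol{\alpha}_{s+u})\Big)\zeta_{\mathscr{A}}(\boldsymbol{\alpha}_1,\ldots,\boldsymbol{\alpha}_s,\boldsymbol{\alpha}_{s+t},\ldots,\boldsymbol{\alpha}_{s+1})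 \] \[ =\sum_{\sigma\in W_{s,t}}\ \sum_{\substack{\boldsymbol{r}\in Z_{s+t,n}\\ \boldsymbol{k}\in Z_{s+t,m}}}\Big(\prod_{l=1}^{s+t} P_l^{\sigma}(\boldsymbol{\lambda},\boldsymbol{\lambda}')^{r_l}\,P_l^{\sigma}(\boldsymbol{\mu},\boldsymbol{\mu}')^{k_l}\Big) \sum_{(\boldsymbol{\alpha}_1,\ldots,\boldsymbol{\alpha}_{s+t})\in S(\boldsymbol{r},\boldsymbol{k})}\zeta_{\mathscr{A}}(\boldsymbol{\alpha}_1,\ldots,\boldsymbol{\alpha}_{s+t}), \] where $(\boldsymbol{\alpha}_1,\dots)$ denotes concatenation of the indices (blocks) in the order written, each block keeping its internal order.
   Context: $\mathscr{A}:=\left(\prod_{p \text{ prime}}\mathbb{Z}/p\mathbb{Z}\right)\big/\left(\bigoplus_{p\text{ prime}}\mathbb{Z}/p\mathbb{Z}\right)$. $\mathbb{N}=\{1,2,\dots\}$, $\mathbb{D}:=\mathbb{Z}\setminus\{0\}$; for $a\in\mathbb{D}$, $\mathrm{sgn}(a)\in\{\pm1\}$ is its sign and $|a|$ its absolute value. For an index $\boldsymbol{\alpha}=(\alpha_1,\dots,\alpha_r)\in\mathbb{D}^r$: $|\boldsymbol{\alpha}|=\sum|\alpha_i|$, $\mathrm{sgn}(\boldsymbol{\alpha})=\prod\mathrm{sgn}(\alpha_i)$, and $\zeta_{\mathscr{A}}(\boldsymbol{\alpha}):=\left(\sum_{0<m_1<\cdots<m_r<p}\frac{\mathrm{sgn}(\alpha_1)^{m_1}\cdots\mathrm{sgn}(\alpha_r)^{m_r}}{m_1^{|\alpha_1|}\cdots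 m_r^{|\alpha_r|}} \bmod p\right)_p\in\mathscr{A}$. For non-negative integers $i,j$, $S_{i,j}^{\mathrm{sgn}}:=\{\boldsymbol{\alpha}\in\mathbb{D}^{i+1}\mid |\boldsymbol{\alpha}|=i+j+1\}$. For positive integers $N$ and non-negative $M$, $Z_{N,M}:=\{(x_1,\dots,x_N)\in\mathbb{Z}_{\ge0}^N\mid x_1+\cdots+x_N=M\}$. $W_{s,t}:=\{\sigma\in\mathfrak{S}_{s+t}\mid \sigma(1)<\cdots<\sigma(s),\ \sigma(s+1)<\cdots<\sigma(s+t)\}$. For $\sigma\in W_{s,t}$, the linear forms $P_i^\sigma(\boldsymbol{\lambda},\boldsymbol{\lambda}')$ ($1\le i\le s+t$) with integer coefficients are the unique coefficients such that, for $L_1(a,b):=\log\frac{1-a}{1-b}$ and all $0<t_{\sigma^{-1}(1)}<\cdots<t_{\sigma^{-1}(s+t)}<z<1$ (with $t_{\sigma^{-1}(s+t+1)}:=z$), $\sum_{i=1}^{s-1}\lambda_iL_1(t_i,t_{i+1})+\lambda_sL_1(t_s,z)+\sum_{j=s+1}^{s+t-1}\lambda_jL_1(t_j,t_{j+1})+\lambda_{s+t}L_1(t_{s+t},z)=\sum_{i=1}^{s+t}P_i^\sigma(\boldsymbol{\lambda},\boldsymbol{\lambda}')L_1(t_{\sigma^{-1}(i)},t_{\sigma^{-1}(i+1)})$. Explicitly, setting $e(j):=\sigma(j+1)$ for $j\notin\{s,s+t\}$ and $e(s)=e(s+t):=s+t+1$, one has $P_i^\sigma(\boldsymbol{\lambda},\boldsymbol{\lambda}')=\sum_{j:\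 \sigma(j)\le i<e(j)}\lambda_j$. $P_i^\sigma(\boldsymbol{\mu},\boldsymbol{\mu}')$ is the same linear form in $\mu_1,\dots,\mu_{s+t}$. *)

(* Defs.v *)
From HB Require Import structures.
From mathcomp Require Import all_boot all_order all_fingroup all_algebra.
From mathcomp Require Import finmap mpoly.
From mathcomp Require Import boolp classical_sets functions cardinality.

Set Implicit Arguments.
Unset Strict Implicit.
Unset Printing Implicit Defensive.

Import GRing.Theory.
Local Open Scope ring_scope.
Local Open Scope quotient_scope.

Definition primeT := {p : nat | prime p}.

Definition prodFp : Type := forall p : primeT, 'F_(val p).

HB.instance Definition _ := gen_eqMixin prodFp.
HB.instance Definition _ := gen_choiceMixin prodFp.

Section ProdRing.
Implicit Types x y z : prodFp.

Definition pf_zero : prodFp := fun=> 0.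
Definition pf_one : prodFp := fun=> 1.
Definition pf_opp x : prodFp := fun p => - x p.
Definition pf_add x y : prodFp := fun p => x p + y p.
Definition pf_mul x y : prodFp := fun p => x p * y p.

Fact pf_addA : associative pf_add.
Proof. by move=> x y z; apply: functional_extensionality_dep => p; apply: addrA. Qed.
Fact pf_addC : commutative pf_add.
Proof. by move=> x y; apply: functional_extensionality_dep => p; apply: addrC. Qed.
Fact pf_add0 : left_id pf_zero pf_add.
Proof. by move=> x; apply: functional_extensionality_dep => p; apply: add0r. Qed.
Fact pf_addN : left_inverse pf_zero pf_opp pf_add.
Proof. by move=> x; apply: functional_extensionality_dep => p; apply: addNr. Qed.
Fact pf_mulA : associative pf_mul.
Proof. by move=> x y z; apply: functional_extensionality_dep => p; apply: mulrA. Qed.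
Fact pf_mulC : commutative pf_mul.
Proof. by move=> x y; apply: functional_extensionality_dep => p; apply: mulrC. Qed.
Fact pf_mul1 : left_id pf_one pf_mul.
Proof. by move=> x; apply: functional_extensionality_dep => p; apply: mul1r. Qed.
Fact pf_mulD : left_distributive pf_mul pf_add.
Proof. by move=> x y z; apply: functional_extensionality_dep => p; apply: mulrDl. Qed.

Fact pf_one_neq0 : pf_one != pf_zero.
Proof.
apply/eqP => /(congr1 (fun x : prodFp => x (exist prime 2%N isT))).
by move/eqP; rewrite /pf_one /pf_zero oner_eq0.
Qed.

HB.instance Definition _ :=
  GRing.isZmodule.Build prodFp pf_addA pf_addC pf_add0 pf_addN.
HB.instance Definition _ := GRing.Zmodule_isComNzRing.Build prodFp
  pf_mulA pf_mulC pf_mul1 pf_mulD pf_one_neq0.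

End ProdRing.

(* The ideal \bigoplus_p Z/pZ: the families with finite support. *)
Definition sumFp : {pred prodFp} :=
  fun x => `[< finite_set [set p : primeT | x p != 0]%classic >].

Fact sumFp_idealr_closed : idealr_closed sumFp.
Proof.
split.
- apply/asboolP; apply: (@sub_finite_set _ _ classical_sets.set0) => [p /=|]; first by [].
  exact: finite_set0.
- apply/asboolP => fin1.
  have {fin1} : finite_set [set: primeT]%classic.
    by apply: sub_finite_set fin1 => p _; exact: (oner_neq0 'F_(val p)).
  case/finite_seqP => ps Eps.
  have [q q_gt q_pr] := prime_above (\max_(p <- ps) val p).
  have : exist prime q q_pr \in ps.
    by have : [set` ps]%classic (exist prime q q_pr) by rewrite -Eps.
  move=> qps; have := @leq_bigmax_seq _ _ xpredT (fun p : primeT => val p) _ qps isT.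
  by rewrite /= leqNgt q_gt.
move=> a x y /asboolP xfin /asboolP yfin; apply/asboolP.
have := conj xfin yfin; rewrite -finite_setU; apply: sub_finite_set => p /=.
have -> : (a * x + y) p = a p * x p + y p by [].
have [->|xp0] := eqVneq (x p) 0; last by left.
by rewrite mulr0 add0r; right.
Qed.

HB.instance Definition _ := isIdealr.Build prodFp sumFp sumFp_idealr_closed.

Definition calA := {ideal_quot sumFp}.

Definition nzint := {a : int | a != 0}.

Definition sgn (a : seq nzint) : int := \prod_(x <- a) sgz (val x).
Definition weight (a : seq nzint) : nat := (\sum_(x <- a) `|val x|)%N.

Definition zeta_p (a : seq nzint) (p : primeT) : 'F_(val p) :=
  \sum_(m : (size a).-tuple 'I_(val p) | path ltn 0%N [seq val x | x <- m])
    \prod_(i < size a)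
      let ai := val (tnth (in_tuple a) i) in
      let mi := val (tnth m i) in
      (sgz ai)%:~R ^+ mi / mi%:R ^+ `|ai|%N.

Definition zetaA (a : seq nzint) : calA := \pi_calA (zeta_p a : prodFp).

Definition Ssgn (i j : nat) : set (seq nzint) :=
  [set a | size a = i.+1 /\ weight a = (i + j + 1)%N]%classic.

Definition Zset (N M : nat) : set {ffun 'I_N -> nat} :=
  [set x : {ffun 'I_N -> nat} | (\sum_(l < N) x l)%N = M]%classic.
Arguments Zset : clear implicits.

Definition Sprod N (r k : {ffun 'I_N -> nat}) : set {ffun 'I_N -> seq nzint} :=
  [set a : {ffun 'I_N -> seq nzint} | forall l, Ssgn (r l) (k l) (a l)]%classic.

(* The statement sums over [fset_set X], which enumerates X when X is finite and
   is empty otherwise; the next three facts rule out the latter. *)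
Lemma finite_Zset N M : finite_set (Zset N M).
Proof.
pose f (y : {ffun 'I_N -> 'I_M.+1}) : {ffun 'I_N -> nat} := [ffun l => val (y l)].
apply: (@sub_finite_set _ _ (f @` setT)%classic).
  move=> x /= xM; exists [ffun l => inord (x l)] => //.
  apply/ffunP => l; rewrite !ffunE /= inordK // ltnS -xM.
  by rewrite (bigD1 l) //= leq_addr.
exact/finite_image/finite_finset.
Qed.

Lemma finite_Ssgn i j : finite_set (Ssgn i j).
Proof.
pose w := (i + j + 1)%N.
pose g (b : bool * 'I_w.+1) : seq nzint :=
  seq_of_opt (insub (if b.1 then - (b.2 : nat)%:Z else (b.2 : nat)%:Z)).
pose f (y : {ffun 'I_i.+1 -> bool * 'I_w.+1}) : seq nzint :=
  flatten [seq g (y l) | l <- enum 'I_i.+1].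
apply: (@sub_finite_set _ _ (f @` setT)%classic); last first.
  exact/finite_image/finite_finset.
move=> a /= [sza wa].
pose x0 : nzint := exist _ 1 isT.
exists [ffun l : 'I_i.+1 => (val (nth x0 a l) < 0, inord `|val (nth x0 a l)|%N)] => //.
rewrite /f (_ : [seq _ | l <- _] = [seq [:: nth x0 a (val l)] | l <- enum 'I_i.+1]).
  rewrite (map_comp (fun n => [:: nth x0 a n]) val) val_enum_ord.
  rewrite (map_comp (fun x => [:: x])) -sza map_nth_iota0 // take_size.
  by elim: (a) => //= x s ->.
apply: eq_map => l; rewrite ffunE /g /=.
have la : (l < size a)%N by rewrite sza.
have wl : (`|val (nth x0 a l)| < w.+1)%N.
  rewrite ltnS /w -wa /weight (big_nth x0) big_mkord.
  by rewrite (bigD1 (Ordinal la)) //= leq_addr.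
rewrite inordK //.
have -> : (if val (nth x0 a l) < 0 then - (`|val (nth x0 a l)|%N)%:Z
           else (`|val (nth x0 a l)|%N)%:Z) = val (nth x0 a l).
  by case: (val _) => k.
by rewrite valK.
Qed.

Lemma finite_Sprod N (r k : {ffun 'I_N -> nat}) : finite_set (Sprod r k).
Proof.
have E l : exists e : seq (seq nzint), Ssgn (r l) (k l) = [set` e]%classic.
  exact/finite_seqP/finite_Ssgn.
pose e l : seq (seq nzint) := sval (cid (E l)).
have He l : Ssgn (r l) (k l) = [set` e l]%classic by rewrite /e; case: cid.
pose M := (\max_l size (e l))%N.
pose f (y : {ffun 'I_N -> 'I_M.+1}) : {ffun 'I_N -> seq nzint} :=
  [ffun l => nth [::] (e l) (y l)].
apply: (@sub_finite_set _ _ (f @` setT)%classic); last first.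
  exact/finite_image/finite_finset.
move=> a /= Ha; exists [ffun l => inord (index (a l) (e l))] => //.
apply/ffunP => l; rewrite !ffunE; have := Ha l; rewrite He /= => al.
rewrite inordK ?nth_index // ltnS (leq_trans (index_size _ _)) //.
exact: (leq_bigmax (F := fun l => size (e l))).
Qed.

(* Positions are numbered from 0: j : 'I_(s + t) stands for j + 1 in 1..s+t. *)

Definition Wset (s t : nat) : {set 'S_(s + t)} :=
  [set sigma : 'S_(s + t) |
    [forall i : 'I_s, forall j : 'I_s,
       (i < j)%N ==> (sigma (lshift t i) < sigma (lshift t j))%N] &&
    [forall i : 'I_t, forall j : 'I_t,
       (i < j)%N ==> (sigma (rshift s i) < sigma (rshift s j))%N]].

(* The end of the segment of j is s + t exactly when j + 1 is s or s + t (the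
   last position of its block); [insub] fails in the latter case. *)
Definition e_end s t (sigma : 'S_(s + t)) (j : 'I_(s + t)) : nat :=
  match insub j.+1 : option 'I_(s + t) with
  | Some j' => if j.+1 == s then (s + t)%N else sigma j'
  | None => (s + t)%N
  end.

Definition Pform s t (sigma : 'S_(s + t)) (V : nmodType)
    (x : 'I_(s + t) -> V) (i : 'I_(s + t)) : V :=
  \sum_(j < s + t | (sigma j <= i < e_end sigma j)%N) x j.

(* The defining identity of the P_i^sigma, where L_1(a,b) = g a - g b with
   g = log(1 - _), h j = g(t_j), hz = g(z). *)
Section PformSpec.
Variables (R : pzRingType) (s t : nat) (sigma : 'S_(s + t)).
Variables (h : 'I_(s + t) -> R) (hz : R).

Definition next_val (j : 'I_(s + t)) : R :=
  if j.+1 == s then hz else oapp h hz (insub j.+1).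

Definition sorted_val (i : nat) : R :=
  oapp (fun i' => h (sigma^-1%g i')) hz (insub i).

Lemma Pform_spec (x : 'I_(s + t) -> R) : sigma \in Wset s t ->
  \sum_(j < s + t) x j * (h j - next_val j) =
  \sum_(i < s + t) Pform sigma x i * (sorted_val i - sorted_val i.+1).
Proof.
move=> sW.
under [RHS]eq_bigr => i _ do rewrite /Pform big_mkcond mulr_suml.
rewrite exchange_big; apply: eq_bigr => j _ /=.
have sj : sorted_val (sigma j) = h j by rewrite /sorted_val valK /= permK.
have ej : sorted_val (e_end sigma j) = next_val j.
  rewrite /next_val /e_end; case: insubP => [j' _ ej'|_] /=.
    case: ifP => _; first by rewrite /sorted_val insubF // ltnn.
    by rewrite /sorted_val valK /= permK.
  by rewrite if_same /sorted_val insubF // ltnn.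
have le_e : (sigma j <= e_end sigma j)%N.
  rewrite /e_end; case: insubP => [j' _ ej'|_]; last exact: ltnW.
  case: ifP => [_|/negbT js]; first exact: ltnW.
  move: sW; rewrite inE => /andP[/forallP Wl /forallP Wr]; apply: ltnW.
  case: (split_ordP j) (split_ordP j') => [i ei|i ei] [i' ei'|i' ei'];
    move: js ej'; rewrite ei ei' /= => js ej'.
  - by have /forallP/(_ i')/implyP := Wl i; apply; rewrite ej'.
  - by move: js; rewrite eqn_leq (ltn_ord i) -ej' leq_addr.
  - by have := ltn_ord i'; rewrite ej' -addnS ltnNge leq_addr.
  - have /forallP/(_ i')/implyP := Wr i; apply.
    by rewrite -(ltn_add2l s) ej'.
have lt_e : (e_end sigma j <= s + t)%N.
  by rewrite /e_end; case: insubP => // j' _ _; case: ifP => // _; apply: ltnW.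
have -> : h j - next_val j =
          \sum_(sigma j <= i < e_end sigma j) (sorted_val i - sorted_val i.+1).
  rewrite -sj -ej -opprB -(telescope_sumr _ le_e) -sumrN.
  by apply: eq_bigr => i _; rewrite opprB.
rewrite (big_nat_widen _ _ _ _ _ lt_e) big_geq_mkord mulr_sumr big_mkcond /=.
apply: eq_bigr => i _; rewrite andbC.
by case: ifP => _; rewrite ?mul0r.
Qed.
End PformSpec.

Definition lam s t (l : 'I_(s + t)) : {mpoly calA[(s + t) + (s + t)]} :=
  'X_(lshift (s + t) l).
Definition mu s t (l : 'I_(s + t)) : {mpoly calA[(s + t) + (s + t)]} :=
  'X_(rshift (s + t) l).

Definition q_exp s t (r k : {ffun 'I_(s + t) -> nat}) : nat :=
  (\sum_(u < t) (r (rshift s u) + k (rshift s u)) + t)%N.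

Definition concat s t (a : {ffun 'I_(s + t) -> seq nzint}) : seq nzint :=
  flatten [seq a l | l <- enum 'I_(s + t)].

Definition concat_rev s t (a : {ffun 'I_(s + t) -> seq nzint}) : seq nzint :=
  flatten [seq a (lshift t l) | l <- enum 'I_s] ++
  flatten (rev [seq a (rshift s u) | u <- enum 'I_t]).

(* Main.v *)
From HB Require Import structures.
Require Import Defs.
From mathcomp Require Import all_boot all_order all_fingroup all_algebra.
From mathcomp Require Import finmap mpoly.
From mathcomp Require Import boolp classical_sets functions cardinality.
From mathcomp Require Import zify ring.

(** Fix an odd prime p.  In the blocks that carry the sign [sgn] on the left-hand side,
    the substitution m -> p - m multiplies every summand by the sign that [q_exp] and
    [sgn] compensate, and turns the condition that the last index of the first s blocks is
    smaller than the indices of the t remaining ones into a_max + b_max < p.  The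
    left-hand side is therefore the sum of the first p coefficients of a product of two
    series in z, where z marks the largest summation index.

    Nested sums are entries of products of strictly triangular matrices.  Let X and Y mark
    the exponents of lambda and mu.  Summing over the signs keeps the even summation
    indices only, and summing over the exponents turns 1/m into 1/(m - y Y), so that the
    series F_l of l blocks with parameters (x_i, y_i) satisfies
      z F_l' = y_l Y F_l + 2 z^2 / (1 - z^2) (x_l X F_l + F_(l-1))   mod z^p.
    Such an equation determines F_l from F_(l-1) and its constant term, since N - y_l Y is
    invertible for 0 < N < p.  By the Leibniz rule a product F_i G_j satisfies the equation
    with parameters x_i + x'_j and y_i + y'_j and with F_(i-1) G_j + F_i G_(j-1) in place of
    F_(l-1); so does the sum of the series attached to the shuffles of the two lists of
    blocks, and the parameters met along a shuffle sigma are the P_i^sigma. *)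

Set Implicit Arguments.
Unset Strict Implicit.
Unset Printing Implicit Defensive.

Import GRing.Theory.
Local Open Scope ring_scope.

(** * Sums over tuples and enumerations *)

(* Unlike [big_enum], this does not require [op] to be commutative. *)
Lemma big_enumT (T : Type) (op : T -> T -> T) (idx : T) (I : finType) (F : I -> T) :
  \big[op/idx]_(i <- enum I) F i = \big[op/idx]_i F i.
Proof. by rewrite [index_enum I]unlock enumT. Qed.

Lemma big_tuple_cons (R : nmodType) (T : finType) n (P : pred (seq T))
    (F : n.+1.-tuple T -> R) :
  \sum_(w : n.+1.-tuple T | P w) F w =
  \sum_c \sum_(w : n.-tuple T | P (c :: w)) F [tuple of c :: w].
Proof.
rewrite pair_big_dep /=.
rewrite (reindex (fun cw : T * n.-tuple T => [tuple of cw.1 :: cw.2])) //=.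
exists (fun w => (thead w, [tuple of behead w])) => [[c w]|w] _ /=.
  by rewrite theadE; congr (_, _); apply: val_inj.
by rewrite [RHS]tuple_eta.
Qed.

Lemma big_tuple_rcons (R : nmodType) (T : finType) n (P : pred (seq T))
    (F : n.+1.-tuple T -> R) :
  \sum_(w : n.+1.-tuple T | P w) F w =
  \sum_c \sum_(w : n.-tuple T | P (rcons w c)) F [tuple of rcons w c].
Proof.
rewrite pair_big_dep /=.
rewrite (reindex (fun cw : T * n.-tuple T => [tuple of rcons cw.2 cw.1])) //=.
pose init (w : n.+1.-tuple T) := [tuple of belast (thead w) (behead w)].
exists (fun w => (last (thead w) (behead w), init w)) => [[c w]|w] _ /=; last first.
  by apply: val_inj; case/tupleP: w => a w /=; rewrite theadE -lastI.
congr (_, _); last apply: val_inj; case: w => -[|a w] //= sw.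
  by rewrite last_rcons.
by rewrite belast_rcons.
Qed.

(** * Formal power series *)

(* A wrapper rather than [nat -> R], which already has the pointwise ring structure. *)
Record fps (R : Type) := Fps {coef_fps :> nat -> R}.
Arguments Fps {R}.

Lemma fpsP (R : Type) (f g : fps R) : f =1 g -> f = g.
Proof. by case: f g => f [g] /funext /= ->. Qed.

HB.instance Definition _ (R : Type) := gen_eqMixin (fps R).
HB.instance Definition _ (R : Type) := gen_choiceMixin (fps R).

Section FpsRing.
Variable R : comNzRingType.
Implicit Types f g h : fps R.

Definition fps_zero : fps R := Fps (fun=> 0).
Definition fps_opp f : fps R := Fps (fun n => - f n).
Definition fps_add f g : fps R := Fps (fun n => f n + g n).
Definition fps_one : fps R := Fps (fun n => (n == 0%N)%:R).
Definition fps_mul f g : fps R := Fps (fun n => \sum_(i < n.+1) f i * g (n - i)%N).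

Fact fps_addA : associative fps_add.
Proof. by move=> f g h; apply: fpsP => n /=; rewrite addrA. Qed.
Fact fps_addC : commutative fps_add.
Proof. by move=> f g; apply: fpsP => n /=; rewrite addrC. Qed.
Fact fps_add0 : left_id fps_zero fps_add.
Proof. by move=> f; apply: fpsP => n /=; rewrite add0r. Qed.
Fact fps_addN : left_inverse fps_zero fps_opp fps_add.
Proof. by move=> f; apply: fpsP => n /=; rewrite addNr. Qed.

Lemma coef_fps_mul_poly (P Q : {poly R}) f g n :
  (forall i, (i <= n)%N -> P`_i = f i) -> (forall i, (i <= n)%N -> Q`_i = g i) ->
  fps_mul f g n = (P * Q)`_n.
Proof.
move=> Pf Qg; rewrite coefM; apply: eq_bigr => i _.
by rewrite Pf ?Qg ?leq_subr // -ltnS.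
Qed.

Definition fps_trunc n f : {poly R} := \poly_(i < n.+1) f i.

Lemma coef_fps_trunc n f i : (i <= n)%N -> (fps_trunc n f)`_i = f i.
Proof. by move=> le_in; rewrite coef_poly ltnS le_in. Qed.

Lemma coef_fps_mul_trunc n f g i : (i <= n)%N ->
  fps_mul f g i = (fps_trunc n f * fps_trunc n g)`_i.
Proof.
move=> le_in; apply: coef_fps_mul_poly => j le_ji;
  by rewrite coef_fps_trunc // (leq_trans le_ji).
Qed.

Fact fps_mulA : associative fps_mul.
Proof.
move=> f g h; apply: fpsP => n.
rewrite (@coef_fps_mul_poly (fps_trunc n f) (fps_trunc n g * fps_trunc n h)).
- rewrite (@coef_fps_mul_poly (fps_trunc n f * fps_trunc n g) (fps_trunc n h)) ?mulrA //.
  + by move=> i /coef_fps_mul_trunc->.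
  + exact: coef_fps_trunc.
- exact: coef_fps_trunc.
- by move=> i /coef_fps_mul_trunc->.
Qed.
Fact fps_mulC : commutative fps_mul.
Proof. by move=> f g; apply: fpsP => n; rewrite !(coef_fps_mul_trunc _ _ (leqnn n)) mulrC. Qed.
Fact fps_mul1 : left_id fps_one fps_mul.
Proof.
move=> f; apply: fpsP => n /=.
by rewrite big_ord_recl mul1r subn0 big1 ?addr0 // => i _; rewrite mul0r.
Qed.
Fact fps_mulD : left_distributive fps_mul fps_add.
Proof.
by move=> f g h; apply: fpsP => n /=; rewrite -big_split; apply: eq_bigr => i _; rewrite mulrDl.
Qed.
Fact fps_one_neq0 : fps_one != fps_zero.
Proof. by apply/eqP => /(congr1 (fun f : fps R => f 0%N)) /eqP; rewrite oner_eq0. Qed.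

HB.instance Definition _ :=
  GRing.isZmodule.Build (fps R) fps_addA fps_addC fps_add0 fps_addN.
HB.instance Definition _ := GRing.Zmodule_isComNzRing.Build (fps R)
  fps_mulA fps_mulC fps_mul1 fps_mulD fps_one_neq0.

Definition fpscoef (n : nat) f : R := f n.
Definition fpsC (c : R) : fps R := Fps (fun n => c *+ (n == 0%N)).
Definition fpsX : fps R := Fps (fun n => (n == 1%N)%:R).

Lemma coef_fpsM f g n : (f * g) n = \sum_(i < n.+1) f i * g (n - i)%N.
Proof. by []. Qed.

Lemma coef_fpsB f g n : (f - g) n = f n - g n.
Proof. by []. Qed.

Fact fpscoef_is_additive n : zmod_morphism (fpscoef n).
Proof. by []. Qed.
HB.instance Definition _ n :=
  GRing.isZmodMorphism.Build (fps R) R (fpscoef n) (fpscoef_is_additive n).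

Lemma coef_fps_sum (I : Type) (r : seq I) (P : pred I) (F : I -> fps R) n :
  (\sum_(i <- r | P i) F i) n = \sum_(i <- r | P i) F i n.
Proof. exact: (raddf_sum (fpscoef n)). Qed.

Lemma coef_fpsCM c f n : (fpsC c * f) n = c * f n.
Proof.
by rewrite coef_fpsM big_ord_recl subn0 big1 ?addr0 // => i _; rewrite /= mul0r.
Qed.

Lemma coef_fpsMC f c n : (f * fpsC c) n = f n * c.
Proof. by rewrite mulrC coef_fpsCM mulrC. Qed.

Lemma coef_fpsXM f n : (fpsX * f) n = if n is n'.+1 then f n' else 0.
Proof.
rewrite coef_fpsM big_ord_recl mul0r add0r; case: n => [|n]; first by rewrite big_ord0.
by rewrite big_ord_recl mul1r subSS subn0 big1 ?addr0 // => i _; apply: mul0r.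
Qed.

Fact fpsC_is_additive : zmod_morphism fpsC.
Proof. by move=> c d; apply: fpsP => n /=; apply: mulrnBl. Qed.
Fact fpsC_is_multiplicative : monoid_morphism fpsC.
Proof.
split=> [|c d]; apply: fpsP => n; first by [].
by rewrite coef_fpsCM /= mulrnAr.
Qed.
HB.instance Definition _ :=
  GRing.isZmodMorphism.Build R (fps R) fpsC fpsC_is_additive.
HB.instance Definition _ :=
  GRing.isMonoidMorphism.Build R (fps R) fpsC fpsC_is_multiplicative.

Definition fps_geom (v c : R) : fps R := Fps (fun n => v ^+ n.+1 * c ^+ n).

Lemma fps_geomK (v a c : R) : v * a = 1 ->
  (fpsC a - fpsC c * fpsX) * fps_geom v c = 1.
Proof.
move=> va; apply: fpsP => n.
rewrite mulrBl coef_fpsB coef_fpsCM -mulrA coef_fpsCM coef_fpsXM.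
case: n => [|n] /=; first by rewrite !expr1 mulr1 mulr0 subr0 mulrC.
suff -> : a * (v ^+ n.+2 * c ^+ n.+1) = (v * a) * (v ^+ n.+1 * c ^+ n.+1).
  by rewrite va mul1r (exprS c) mulrCA subrr.
by rewrite [v ^+ n.+2]exprS; ring.
Qed.

End FpsRing.

Lemma fps_mxP (R : comNzRingType) m n (M M' : 'M[fps R]_(m, n)) :
  (forall k, map_mx (fpscoef k) M = map_mx (fpscoef k) M') -> M = M'.
Proof.
move=> eqM; apply/matrixP => i j; apply: fpsP => k.
by have /matrixP/(_ i j) := eqM k; rewrite !mxE.
Qed.

Lemma map_fpscoefM (R : comNzRingType) m n q (M : 'M[fps R]_(m, n)) (M' : 'M[fps R]_(n, q)) k :
  map_mx (fpscoef k) (M *m M') =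
  \sum_(i < k.+1) map_mx (fpscoef i) M *m map_mx (fpscoef (k - i)) M'.
Proof.
apply/matrixP => a b; rewrite !mxE raddf_sum summxE exchange_big.
by apply: eq_bigr => i _; rewrite mxE; apply: eq_bigr => h _; rewrite !mxE.
Qed.

Lemma map_fpscoef_mulC (R : comNzRingType) m n q (M : 'M[fps R]_(m, n)) (M' : 'M[R]_(n, q)) k :
  map_mx (fpscoef k) (M *m map_mx (@fpsC R) M') = map_mx (fpscoef k) M *m M'.
Proof.
apply/matrixP => a b; rewrite !mxE raddf_sum; apply: eq_bigr => h _.
by rewrite !mxE; apply: coef_fpsMC.
Qed.

(** * Shuffle products of solutions of a differential equation *)

Section TruncatedPolynomials.
Variables (A : comNzRingType) (p : nat).
Implicit Types F G H : {poly A}.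

Definition eq_upto F G : Prop := forall N, (N < p)%N -> F`_N = G`_N.

Lemma eq_upto_trans F G H : eq_upto F G -> eq_upto G H -> eq_upto F H.
Proof. by move=> FG GH N Np; rewrite FG ?GH. Qed.

Lemma eq_uptoD F F' G G' : eq_upto F F' -> eq_upto G G' -> eq_upto (F + G) (F' + G').
Proof. by move=> FF' GG' N Np; rewrite !coefD FF' ?GG'. Qed.

Lemma eq_uptoMl H F G : eq_upto F G -> eq_upto (H * F) (H * G).
Proof.
move=> FG N Np; rewrite !coefM; apply: eq_bigr => M _.
by rewrite FG // (leq_ltn_trans (leq_subr _ _)).
Qed.

Lemma eq_upto_sum (I : Type) (r : seq I) (P : pred I) (F G : I -> {poly A}) :
  (forall i, P i -> eq_upto (F i) (G i)) ->
  eq_upto (\sum_(i <- r | P i) F i) (\sum_(i <- r | P i) G i).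
Proof. by move=> FG N Np; rewrite !coef_sum; apply: eq_bigr => i /FG->. Qed.

Variable E : {poly A}.
Hypothesis E0 : E`_0 = 0.

(* [z F' = b F + E (a F + G)] modulo [z^p]. *)
Definition ode_solution (a b : A) (G F : {poly A}) : Prop :=
  eq_upto ('X * F^`()) (b%:P * F + E * (a%:P * F + G)).

Lemma coef_X_deriv F N : ('X * F^`())`_N = N%:R * F`_N.
Proof. by rewrite coefXM; case: N => [|N]; rewrite ?mul0r //= coef_deriv mulr_natl. Qed.

Lemma coefM_lt_eq F G N : (forall M, (M < N)%N -> F`_M = G`_M) -> (E * F)`_N = (E * G)`_N.
Proof.
move=> FG; rewrite !coefM; apply: eq_bigr => -[[|M] /= leMN] _; first by rewrite E0 !mul0r.
by rewrite FG //; lia.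
Qed.

Lemma ode_solution_uniq a b G G' F F' :
  (forall N, (0 < N < p)%N -> GRing.lreg (N%:R - b)) ->
  ode_solution a b G F -> ode_solution a b G' F' ->
  eq_upto G G' -> F`_0 = F'`_0 -> eq_upto F F'.
Proof.
move=> reg solF solF' GG' FF'0 N; have [d] := ubnP N.
elim: d N => // d IHd [|N] //; rewrite ltnS => leNd Np; apply: (reg N.+1 Np).
have E_eq : (E * (a%:P * F + G))`_N.+1 = (E * (a%:P * F' + G'))`_N.+1.
  apply: coefM_lt_eq => M ltMN.
  by rewrite !coefD !coefCM GG' ?IHd //; lia.
have := solF _ Np; have := solF' _ Np.
rewrite !coef_X_deriv !coefD !coefCM E_eq !mulrBl => -> ->; ring.
Qed.

Lemma ode_solutionM a b G F a' b' G' F' :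
  ode_solution a b G F -> ode_solution a' b' G' F' ->
  ode_solution (a + a') (b + b') (G * F' + F * G') (F * F').
Proof.
move=> solF solF'; rewrite /ode_solution derivM.
have -> : 'X * (F^`() * F' + F * F'^`()) = F' * ('X * F^`()) + F * ('X * F'^`()) by ring.
apply: eq_upto_trans (eq_uptoD (eq_uptoMl F' solF) (eq_uptoMl F solF')) _.
by move=> N _; rewrite !polyCD; apply: (congr1 (fun P : {poly A} => P`_N)); ring.
Qed.

Lemma ode_solution_sum (I : Type) (r : seq I) (P : pred I) a b (G F : I -> {poly A}) :
  (forall i, P i -> ode_solution a b (G i) (F i)) ->
  ode_solution a b (\sum_(i <- r | P i) G i) (\sum_(i <- r | P i) F i).
Proof.
move=> sol; rewrite /ode_solution raddf_sum !mulr_sumr -big_split mulr_sumr -big_split.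
exact: eq_upto_sum.
Qed.

End TruncatedPolynomials.

(* A word of booleans shuffles two sequences of labels: [false] takes the next term of
   the first one, [true] that of the second one. *)
Section WordLabels.
Variable V : nmodType.
Implicit Types (x y : nat -> V) (w : seq bool).

Definition last_label x (i : nat) : V := if i is i'.+1 then x i' else 0.

Definition merge_labels x y w (i : nat) : V :=
  last_label x (count negb (take i.+1 w)) + last_label y (count id (take i.+1 w)).

Lemma merge_labels_rcons x y w c i : (i < size w)%N ->
  merge_labels x y (rcons w c) i = merge_labels x y w i.
Proof. by move=> iw; rewrite /merge_labels -cats1 takel_cat. Qed.

Lemma merge_labels_last x y k s t w : k.+1 = (s + t)%N -> size w = k.+1 ->
  count id w = t -> merge_labels x y w k = last_label x s + last_label y t.
Proof.
move=> kE sw wt; rewrite /merge_labels take_oversize ?sw // wt.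
have : (count id w + count negb w)%N = k.+1 by rewrite -sw; apply: count_predC.
by rewrite wt kE addnC => /addIn->.
Qed.

Lemma big_word_rcons (R : nmodType) x y k t (F : (nat -> V) -> R) :
  (forall x x', (forall i, (i < k)%N -> x i = x' i) -> F x = F x') ->
  \sum_(w : k.+1.-tuple bool | count id w == t) F (merge_labels x y w) =
  (if t is t'.+1 then \sum_(w : k.-tuple bool | count id w == t') F (merge_labels x y w)
   else 0) +
  \sum_(w : k.-tuple bool | count id w == t) F (merge_labels x y w).
Proof.
move=> eqF; rewrite (big_tuple_rcons (fun w => count id w == t)).
have dropF c (w : k.-tuple bool) : F (merge_labels x y (rcons w c)) = F (merge_labels x y w).
  by apply: eqF => i ik; rewrite merge_labels_rcons // size_tuple.
have countE c (w : k.-tuple bool) : count id (rcons w c) = (c + count id w)%N.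
  by rewrite -cats1 count_cat /= addn0 addnC.
rewrite big_bool; congr (_ + _).
  case: t => [|t]; first by apply: big_pred0 => w; rewrite countE.
  by apply: eq_big => w; rewrite ?countE ?dropF.
by apply: eq_big => w; rewrite ?countE ?dropF.
Qed.

End WordLabels.

Section ShuffleProduct.
Variables (A : comNzRingType) (p : nat) (E : {poly A}) (V : nmodType).
Variables (xi eta : {additive V -> A}) (sol : (nat -> V) -> nat -> {poly A}).
Hypothesis E0 : E`_0 = 0.
Hypothesis eta_reg : forall v N, (0 < N < p)%N -> GRing.lreg (N%:R - eta v).
Hypothesis eq_sol : forall x y k, (forall i, (i < k)%N -> x i = y i) -> sol x k = sol y k.
Hypothesis sol0 : forall x, sol x 0 = 1.
Hypothesis solS_0 : forall x k, (sol x k.+1)`_0 = 0.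
Hypothesis solS : forall x k,
  ode_solution p E (xi (x k)) (eta (x k)) (sol x k) (sol x k.+1).

Let sol_pred x k : {poly A} := if k is k'.+1 then sol x k' else 0.

Lemma sol_ode x k :
  ode_solution p E (xi (last_label x k)) (eta (last_label x k)) (sol_pred x k) (sol x k).
Proof.
case: k => [|k]; last exact: solS.
by move=> N _; rewrite sol0 -polyC1 derivC /= !raddf0 !(mul0r, addr0, mulr0).
Qed.

Lemma sol_coef0 x k : (sol x k)`_0 = (k == 0%N)%:R.
Proof. by case: k => [|k]; rewrite ?solS_0 // sol0 coefC. Qed.

Theorem shuffle_product x y k s t : k = (s + t)%N ->
  eq_upto p (sol x s * sol y t)
    (\sum_(w : k.-tuple bool | count id w == t) sol (merge_labels x y w) k).
Proof.
elim: k s t => [|k IHk] s t kE.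
  case: s t kE => [|s] [|t] // _ N _.
  rewrite (big_pred1 [tuple]) ?sol0 ?mulr1 // => w.
  by rewrite [w]tuple0; apply/esym/eqP.
have sourceE : eq_upto p (sol_pred x s * sol y t + sol x s * sol_pred y t)
    (\sum_(w : k.+1.-tuple bool | count id w == t) sol (merge_labels x y w) k).
  rewrite (big_word_rcons _ _ _ (fun x x' => @eq_sol x x' k)) addrC.
  apply: eq_uptoD.
    by case: t kE => [|t] kE; [rewrite mulr0 | apply: IHk; lia].
  case: s kE => [|s] kE; last by apply: IHk; lia.
  rewrite mul0r big_pred0 // => w; apply/negbTE/eqP => wt.
  by have := count_size id w; rewrite size_tuple wt; lia.
apply: ode_solution_uniq (ode_solutionM (sol_ode x s) (sol_ode y t)) _ sourceE _ => //.
- by move=> N; rewrite -raddfD; apply: eta_reg.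
- rewrite -!raddfD; apply: ode_solution_sum => w /eqP wt.
  by rewrite -(merge_labels_last x y kE (size_tuple w) wt).
rewrite coef_sum big1 => [|w _]; last exact: solS_0.
rewrite coef0M !sol_coef0 -natrM mulnb; case: s kE => [|s] //.
by case: t.
Qed.

End ShuffleProduct.

(** * Shuffle permutations and words *)

Lemma sorted_ltn_enum n (f : 'I_n -> nat) :
  reflect {homo f : i j / (i < j)%N} (sorted ltn [seq f i | i <- enum 'I_n]).
Proof.
apply: (iffP idP) => [f_sorted i j lt_ij|f_incr].
  have nth_f (k : 'I_n) : nth 0%N [seq f l | l <- enum 'I_n] k = f k.
    by rewrite (nth_map k) ?size_enum_ord ?nth_ord_enum.
  rewrite -(nth_f i) -nth_f; apply: (sorted_ltn_nth ltn_trans) => //;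
    by rewrite inE size_map size_enum_ord.
rewrite sorted_map; apply: (@sub_sorted _ (relpre val ltn)); first by move=> i j; apply: f_incr.
by rewrite -sorted_map val_enum_ord iota_ltn_sorted.
Qed.

Lemma sorted_eq_filter_enum n (P : pred 'I_n) (l : seq 'I_n) :
  l =i [seq i <- enum 'I_n | P i] ->
  sorted ltn [seq val i | i <- l] = (l == [seq i <- enum 'I_n | P i]).
Proof.
move=> lP; have filter_sorted : sorted ltn [seq val i | i <- enum 'I_n & P i].
  rewrite sorted_map; apply: sorted_filter; first by move=> j i k; apply: ltn_trans.
  by rewrite -sorted_map val_enum_ord iota_ltn_sorted.
apply/idP/eqP => [l_sorted|->//]; apply: (inj_map val_inj).
apply: (irr_sorted_eq ltn_trans ltnn l_sorted filter_sorted) => i.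
exact: eq_mem_map.
Qed.

Lemma codom_split (T : Type) s t (f : 'I_(s + t) -> T) :
  codom f = codom (f \o @lshift s t) ++ codom (f \o @rshift s t).
Proof.
have enumE : enum 'I_(s + t) = codom (@lshift s t) ++ codom (@rshift s t).
  apply: (inj_map val_inj); rewrite !codomE map_cat val_enum_ord iotaD; congr (_ ++ _).
    by rewrite -(map_comp _ (@lshift s t)) -val_enum_ord; apply: eq_map.
  rewrite add0n -{1}[s]addn0 iotaDl -val_enum_ord.
  by rewrite -(map_comp _ (@rshift s t)) -(map_comp (addn s)); apply: eq_map.
by rewrite codomE enumE map_cat !codomE -(map_comp _ (@lshift s t)) -(map_comp _ (@rshift s t)).
Qed.

Section ShuffleWords.
Variables (s t : nat).
Implicit Types (sigma : 'S_(s + t)) (w : (s + t).-tuple bool).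

Lemma WsetP sigma : reflect
  ({homo sigma \o @lshift s t : i j / (i < j)%N} /\
   {homo sigma \o @rshift s t : i j / (i < j)%N})
  (sigma \in Wset s t).
Proof.
rewrite inE; apply: (iffP andP) => -[incr_l incr_r]; split.
- by move=> i j; move/forallP/(_ i)/forallP/(_ j)/implyP: incr_l.
- by move=> i j; move/forallP/(_ i)/forallP/(_ j)/implyP: incr_r.
- by apply/forallP => i; apply/forallP => j; apply/implyP/incr_l.
- by apply/forallP => i; apply/forallP => j; apply/implyP/incr_r.
Qed.

Definition word_of sigma : (s + t).-tuple bool :=
  [tuple (s <= (sigma^-1)%g i)%N | i < s + t].

Lemma tnth_word_of sigma j : tnth (word_of sigma) (sigma j) = (s <= j)%N.
Proof. by rewrite tnth_mktuple permK. Qed.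

Definition positions_of (c : bool) w : seq 'I_(s + t) :=
  [seq i <- enum 'I_(s + t) | tnth w i == c].

Lemma mem_positions_of c w i : (i \in positions_of c w) = (tnth w i == c).
Proof. by rewrite mem_filter mem_enum andbT. Qed.

Lemma uniq_positions_of c w : uniq (positions_of c w).
Proof. exact: filter_uniq (enum_uniq _). Qed.

Lemma size_positions_of c w : size (positions_of c w) = count_mem c w.
Proof. by rewrite size_filter -[in RHS](map_tnth_enum w) (count_map (tnth w)). Qed.

Definition word_positions w : seq 'I_(s + t) := positions_of false w ++ positions_of true w.

Lemma uniq_word_positions w : uniq (word_positions w).
Proof.
rewrite cat_uniq !uniq_positions_of andbT; apply/hasPn => i /=.
by rewrite !mem_positions_of => /eqP->.
Qed.

Lemma size_word_positions w : size (word_positions w) == (s + t)%N.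
Proof.
rewrite size_cat !size_positions_of -{3}(size_tuple w) -(count_predC (pred1 false) w).
by rewrite eqn_add2l; apply/eqP/eq_count => -[].
Qed.

Lemma codom_lshift_positions sigma :
  codom (sigma \o @lshift s t) =i positions_of false (word_of sigma).
Proof.
move=> i; rewrite mem_positions_of -[i](permKV sigma) tnth_word_of.
case: (split_ordP (sigma^-1%g i)) => j ->.
  by rewrite /= leqNgt ltn_ord; apply/codomP; exists j.
rewrite /= leq_addr; apply/codomP => -[j' /perm_inj /eqP].
by rewrite eq_sym eq_lrshift.
Qed.

Lemma codom_rshift_positions sigma :
  codom (sigma \o @rshift s t) =i positions_of true (word_of sigma).
Proof.
move=> i; rewrite mem_positions_of -[i](permKV sigma) tnth_word_of.
case: (split_ordP (sigma^-1%g i)) => j ->.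
  rewrite /= leqNgt ltn_ord; apply/codomP => -[j' /perm_inj /eqP].
  by rewrite eq_lrshift.
by rewrite /= leq_addr; apply/codomP; exists j.
Qed.

Lemma Wset_codom sigma :
  (sigma \in Wset s t) = (codom sigma == word_positions (word_of sigma)).
Proof.
have size_left : size (codom (sigma \o @lshift s t)) = size (positions_of false (word_of sigma)).
  apply/perm_size/uniq_perm.
  - by apply/injectiveP => i j /perm_inj /lshift_inj.
  - exact: uniq_positions_of.
  - exact: codom_lshift_positions.
rewrite codom_split eqseq_cat //.
rewrite -(sorted_eq_filter_enum (codom_lshift_positions sigma)).
rewrite -(sorted_eq_filter_enum (codom_rshift_positions sigma)) !codomE.
rewrite -(map_comp val (sigma \o @lshift s t)) -(map_comp val (sigma \o @rshift s t)).
by apply/WsetP/andP => -[incr_l incr_r]; split; apply/sorted_ltn_enum.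
Qed.

Lemma word_positions_inj w : injective (tnth (Tuple (size_word_positions w))).
Proof. exact/tuple_uniqP/uniq_word_positions. Qed.

Definition perm_of_word w : 'S_(s + t) := perm (@word_positions_inj w).

Lemma codom_perm_of_word w : codom (perm_of_word w) = word_positions w.
Proof.
rewrite codomE (eq_map (permE _)).
exact: map_tnth_enum (Tuple (size_word_positions w)).
Qed.

Lemma perm_of_word_of sigma : (perm_of_word (word_of sigma) == sigma) = (sigma \in Wset s t).
Proof.
rewrite Wset_codom -codom_perm_of_word; apply/eqP/eqP => [->//|eq_codom].
by apply/permP => i; move: eq_codom; rewrite !codomE => /eq_in_map->; rewrite ?mem_enum.
Qed.

Lemma count_take_word_of (a : pred bool) sigma n : (n <= s + t)%N ->
  count a (take n (word_of sigma)) =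
  (a false * #|[pred j : 'I_s | sigma (lshift t j) < n]| +
   a true * #|[pred j : 'I_t | sigma (rshift s j) < n]|)%N.
Proof.
move=> le_n; have -> : count a (take n (word_of sigma)) =
    (\sum_(i < s + t | (i < n)%N) a (tnth (word_of sigma) i))%N.
  rewrite -sum1_count big_mkcond (big_nth false) size_takel ?size_tuple // big_mkord.
  rewrite (big_ord_widen _ (fun i => if a (nth false (take n (word_of sigma)) i) then 1 else 0)%N
    le_n).
  by apply: eq_bigr => i lt_in; rewrite nth_take // -tnth_nth; case: (a _).
rewrite (reindex_inj (@perm_inj _ sigma)) big_mkcond big_split_ord -!big_mkcond /=.
rewrite -!sum1_card !big_distrr /=.
congr (_ + _)%N; apply: eq_bigr => j _; rewrite tnth_word_of muln1 /=.
  by rewrite leqNgt ltn_ord.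
by rewrite leq_addr.
Qed.

Lemma count_word_of sigma : count id (word_of sigma) = t.
Proof.
rewrite -[X in count id X]take_size size_tuple count_take_word_of // add0n mul1n.
by rewrite -[RHS]card_ord; apply: eq_card => j; rewrite inE ltn_ord.
Qed.

Lemma perm_of_wordK w : count id w = t -> word_of (perm_of_word w) = w.
Proof.
move=> wt; have size_true : size (positions_of true w) = t.
  by rewrite size_positions_of -[RHS]wt; apply: eq_count => -[].
have size_false : size (positions_of false w) = s.
  by have := eqP (size_word_positions w); rewrite size_cat size_true => /addIn.
apply: eq_from_tnth => i; rewrite -[i](permKV (perm_of_word w)) tnth_word_of.
move: (_ i) => j; rewrite permE (tnth_nth i) nth_cat size_false ltnNge.
apply/esym/eqP; case: leqP => [le_sj|lt_js] /=; rewrite -mem_positions_of mem_nth //.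
  by rewrite size_true; have := ltn_ord j; lia.
by rewrite size_false.
Qed.

Lemma sum_Wset_words (R : nmodType) (F : (s + t).-tuple bool -> R) :
  \sum_(sigma in Wset s t) F (word_of sigma) = \sum_(w | count id (val w) == t) F w.
Proof.
rewrite [RHS](reindex_onto word_of perm_of_word) => [|w /eqP /perm_of_wordK //].
by apply: eq_bigl => sigma; rewrite perm_of_word_of count_word_of eqxx.
Qed.

End ShuffleWords.

(* [f j.+1] read as the end of the range [0, k] when [j] is the last position. *)
Definition next_position k r (f : 'I_r -> 'I_k) (j : 'I_r) : nat :=
  oapp (fun j' => val (f j')) k (insub j.+1).

Lemma e_end_lshift s t (sigma : 'S_(s + t)) (j : 'I_s) :
  e_end sigma (lshift t j) = next_position (sigma \o @lshift s t) j.
Proof.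
rewrite /e_end /next_position /=; case: insubP => [j' _ jE|]; last first.
  by move=> le_stj; rewrite insubF //; apply/negbTE; have := ltn_ord j; lia.
case: eqP => [->|/eqP js]; first by rewrite insubF ?ltnn.
have lt_js : (j.+1 < s)%N by rewrite ltn_neqAle js ltn_ord.
by rewrite insubT /=; congr (val (sigma _)); apply: val_inj.
Qed.

Lemma e_end_rshift s t (sigma : 'S_(s + t)) (j : 'I_t) :
  e_end sigma (rshift s j) = next_position (sigma \o @rshift s t) j.
Proof.
rewrite /e_end /next_position /= -addnS; case: insubP => [j' + jE|]; last first.
  by rewrite ltn_add2l => /negbTE lt_jt; rewrite insubF.
rewrite ltn_add2l => lt_jt; rewrite insubT (_ : (s + j.+1)%N == s = false); last by lia.
by congr (val (sigma _)); apply: val_inj; rewrite jE.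
Qed.

Section IncreasingPositions.
Variables (V : nmodType) (k r : nat) (f : 'I_r -> 'I_k).
Hypothesis f_incr : {homo f : i j / (i < j)%N}.

Let below i := #|[pred j : 'I_r | f j <= i]|%N.

Lemma le_position_below i j : (f j <= i)%N = (j < below i)%N.
Proof.
have card_lt n : (n <= r)%N -> #|[pred l : 'I_r | l < n]%N| = n.
  by move=> le_nr; rewrite -sum1_card -(big_ord_widen _ (fun=> 1%N) le_nr) sum1_card card_ord.
have f_homo (l l' : 'I_r) : (l <= l')%N -> (f l <= f l')%N.
  by rewrite leq_eqVlt => /predU1P[/val_inj->//|/f_incr /ltnW].
apply/idP/idP => [le_fj|]; last (apply: contraLR; rewrite -!ltnNge ltnS).
  rewrite -(card_lt j.+1) //; apply/subset_leq_card/fintype.subsetP => l.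
  by rewrite !inE => /f_homo /leq_trans; apply.
move=> lt_if; rewrite -[X in (_ <= X)%N](card_lt j (ltnW (ltn_ord j))).
apply/subset_leq_card/fintype.subsetP => l; rewrite !inE => le_fl.
by rewrite ltnNge; apply/negP => /f_homo; lia.
Qed.

Lemma sum_between_positions (x : nat -> V) (i : 'I_k) :
  \sum_(j < r | (f j <= i < next_position f j)%N) x j = last_label x (below i).
Proof.
have below_r : (below i <= r)%N by rewrite -[X in (_ <= X)%N]card_ord max_card.
have betweenE (j : 'I_r) : (f j <= i < next_position f j)%N = (j.+1 == below i).
  rewrite le_position_below /next_position; case: insubP => [j' _ /= <-|] /=.
    by rewrite ltnNge le_position_below; lia.
  by rewrite ltn_ord; lia.
under eq_bigl => j do rewrite betweenE.
case: (below i) below_r => [|c] lt_cr /=; first by rewrite big_pred0.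
by rewrite (big_pred1 (Ordinal lt_cr)).
Qed.

End IncreasingPositions.

Lemma Pform_merge_labels (V : nmodType) s t (sigma : 'S_(s + t))
    (x : 'I_(s + t) -> V) (xl xr : nat -> V) i :
  sigma \in Wset s t ->
  (forall j, x (lshift t j) = xl j) -> (forall j, x (rshift s j) = xr j) ->
  Pform sigma x i = merge_labels xl xr (word_of sigma) i.
Proof.
move=> /WsetP[incr_l incr_r] xlE xrE.
rewrite /merge_labels !count_take_word_of ?ltn_ord //= !mul0n !mul1n addn0 add0n.
rewrite -(sum_between_positions incr_l xl) -(sum_between_positions incr_r xr).
rewrite /Pform big_mkcond big_split_ord /= -!big_mkcond.
by congr (_ + _); apply: eq_big => j; rewrite ?e_end_lshift ?e_end_rshift.
Qed.

(** * Nested sums as products of matrices *)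

Lemma weight_cons (x : nzint) a : weight (x :: a) = (`|val x| + weight a)%N.
Proof. exact: big_cons. Qed.

Lemma weight_rcons a (x : nzint) : weight (rcons a x) = (weight a + `|val x|)%N.
Proof. by rewrite /weight -cats1 big_cat big_seq1. Qed.

Lemma size_le_weight (a : seq nzint) : (size a <= weight a)%N.
Proof.
elim: a => [|x a IHa] //; rewrite weight_cons /=.
by rewrite -add1n leq_add // absz_gt0 (valP x).
Qed.

Lemma sgn_cons (x : nzint) a : sgn (x :: a) = sgz (val x) * sgn a.
Proof. exact: big_cons. Qed.

Lemma sum_coefM (R : comNzRingType) (F G : {poly R}) p :
  \sum_(N < p) (F * G)`_N = \sum_(M < p) F`_M * \sum_(L < p - M) G`_L.
Proof.
under eq_bigr => N _.
  rewrite coefM (big_ord_widen _ (fun M => F`_M * G`_(N - M)) (ltn_ord N)).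
  over.
rewrite (exchange_big_dep xpredT) //=; apply: eq_bigr => M _; rewrite -mulr_sumr.
rewrite -(big_geq_mkord _ _ xpredT (fun N => G`_(N - M))) -[val M]add0n big_addn.
by rewrite big_mkord; congr (_ * _); apply: eq_bigr => L _; rewrite addnK.
Qed.

Section PathMatrices.
Variables (R : comNzRingType) (p : nat) (u : nat -> R).
Implicit Types (x : nzint) (a b : seq nzint).

Definition zeta_term x (N : nat) : R := (sgz (val x))%:~R ^+ N * u N ^+ `|val x|%N.

Definition stepmx x : 'M[R]_p := \matrix_(i, j) if (i < j)%N then zeta_term x j else 0.

(* The entry (i, j) is the sum over the chains i < m_1 < ... < m_r = j, where r = size a. *)
Definition pathmx a : 'M[R]_p := \prod_(x <- a) stepmx x.

Definition origin : 'rV[R]_p := \row_(j < p) (j == 0%N :> nat)%:R.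

Lemma pathmx_cons x a : pathmx (x :: a) = stepmx x *m pathmx a.
Proof. exact: big_cons. Qed.

Lemma pathmx_cat a b : pathmx (a ++ b) = pathmx a *m pathmx b.
Proof. exact: big_cat. Qed.

Lemma pathmx_rcons a x : pathmx (rcons a x) = pathmx a *m stepmx x.
Proof. by rewrite -cats1 pathmx_cat /pathmx big_seq1. Qed.

Lemma pathmx_flatten (aa : seq (seq nzint)) :
  pathmx (flatten aa) = \prod_(a <- aa) pathmx a.
Proof. exact: big_flatten. Qed.

Lemma mul_row_stepmx (v : 'rV[R]_p) x (L : 'I_p) :
  (v *m stepmx x) 0 L = (\sum_(K < L) (rVpoly v)`_K) * zeta_term x L.
Proof.
rewrite (big_ord_widen _ (fun K => (rVpoly v)`_K) (ltnW (ltn_ord L))) !mxE mulr_suml.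
rewrite [RHS]big_mkcond; apply: eq_bigr => K _; rewrite mxE coef_rVpoly_ord.
by case: ifP => _; rewrite ?mulr0.
Qed.

Lemma sum_rVpoly (v : 'rV[R]_p) : \sum_(N < p) (rVpoly v)`_N = \sum_N v 0 N.
Proof. by apply: eq_bigr => N _; rewrite coef_rVpoly_ord. Qed.

Lemma sum_paths_from a (i : 'I_p) :
  \sum_(m : (size a).-tuple 'I_p | path ltn i [seq val j | j <- m])
     \prod_(k < size a) zeta_term (tnth (in_tuple a) k) (tnth m k) =
  \sum_j pathmx a i j.
Proof.
elim: a i => [|x a IHa] i.
  rewrite (big_pred1 [tuple]) => [|m]; last by rewrite [m]tuple0; apply/esym/eqP.
  rewrite big_ord0 /pathmx big_nil (bigD1 i) //= big1 ?addr0 ?mxE ?eqxx // => j /negbTE ji.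
  by rewrite mxE eq_sym ji.
rewrite (big_tuple_cons (fun m : seq 'I_p => path ltn i [seq val j | j <- m])) pathmx_cons /=.
under [RHS]eq_bigr do rewrite mxE.
rewrite exchange_big; apply: eq_bigr => k _ /=; rewrite -mulr_sumr mxE -IHa.
case: ifP => _; last by rewrite mul0r big_pred0.
rewrite mulr_sumr; apply: eq_bigr => m _; rewrite big_ord_recl; congr (_ * _).
by apply: eq_bigr => l _; rewrite !(tnth_nth x) !(tnth_nth k).
Qed.

Lemma rVpoly_origin : (0 < p)%N -> rVpoly origin = 1.
Proof.
move=> p_gt0; apply/polyP => N; rewrite coef_rVpoly coef1.
case: insubP => [i _ <-|]; first by rewrite mxE.
by case: N => [|N] //; rewrite p_gt0.
Qed.

Lemma mul_origin (M : 'M[R]_p) (i j : 'I_p) : i = 0%N :> nat -> (origin *m M) 0 j = M i j.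
Proof.
move=> i0; rewrite mxE (bigD1 i) //= mxE i0 mul1r big1 ?addr0 // => k neq_ki.
by rewrite mxE -i0 (inj_eq val_inj) (negbTE neq_ki) mul0r.
Qed.

Lemma sum_nested a : (0 < p)%N ->
  \sum_(m : (size a).-tuple 'I_p | path ltn 0%N [seq val j | j <- m])
     \prod_(k < size a) zeta_term (tnth (in_tuple a) k) (tnth m k) =
  \sum_j (origin *m pathmx a) 0 j.
Proof.
move=> p_gt0; rewrite (sum_paths_from _ (Ordinal p_gt0)).
by apply: eq_bigr => j _; rewrite (mul_origin _ (i := Ordinal p_gt0)).
Qed.

End PathMatrices.

Section Reflection.
Variables (R : comNzRingType) (p : nat) (u : nat -> R).
Hypotheses (p_odd : odd p) (p_eq0 : p%:R = 0 :> R).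
Hypothesis u_inv : forall N, (0 < N < p)%N -> u N * N%:R = 1.

Definition index_sign (a : seq nzint) : R := (-1) ^+ weight a * (sgn a)%:~R.

Lemma index_sign_cons x a : index_sign (x :: a) = index_sign [:: x] * index_sign a.
Proof.
rewrite /index_sign (weight_cons x a) (sgn_cons x a) /weight /sgn !big_seq1 exprD rmorphM.
by rewrite mulrACA.
Qed.

Lemma u_sub N : (0 < N < p)%N -> u (p - N) = - u N.
Proof.
move=> Np; have pN : (0 < p - N < p)%N by lia.
rewrite -[RHS]mulr1 -(u_inv pN) natrB; last by lia.
by rewrite p_eq0 sub0r mulrCA mulrN mulNr opprK u_inv ?mulr1.
Qed.

Lemma zeta_term_sub x N : (0 < N < p)%N ->
  index_sign [:: x] * zeta_term u x N = zeta_term u x (p - N).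
Proof.
move=> Np; rewrite /zeta_term u_sub // -[- u N]mulN1r exprMn /index_sign /weight /sgn !big_seq1.
have <- : (sgz (val x))%:~R * (sgz (val x))%:~R ^+ N = (sgz (val x))%:~R ^+ (p - N) :> R.
  rewrite -exprS; case: (sgzP (val x)) (valP x) => [_ /eqP[]|_ _|_ _] //=.
    by rewrite !expr1n.
  rewrite mulrN1z -signr_odd -[RHS]signr_odd /= oddB; last by lia.
  by rewrite p_odd.
by ring.
Qed.

Lemma sum_row_pathmx_rev a (M : 'I_p) :
  index_sign a * \sum_N pathmx p u a M N =
  \sum_(L < p - M) (rVpoly (origin R p *m pathmx p u (rev a)))`_L.
Proof.
elim: a M => [|x a IHa] M.
  have pM_gt0 : (0 < p - M)%N by rewrite subn_gt0.
  rewrite /index_sign /weight /sgn /pathmx !big_nil mulmx1 mulr1 mul1r rVpoly_origin; last by lia.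
  rewrite (bigD1 M) //= big1 ?addr0 ?mxE ?eqxx => [|N /negbTE NM]; last by rewrite mxE eq_sym NM.
  case: (p - M)%N pM_gt0 => // d _.
  by rewrite big_ord_recl coef1 big1 ?addr0 // => L _; rewrite coef1.
rewrite pathmx_cons rev_cons pathmx_rcons mulmxA index_sign_cons.
set v := origin R p *m pathmx p u (rev a).
pose tail L := \sum_(K < L) (rVpoly v)`_K.
have -> : \sum_(L < p - M) (rVpoly (v *m stepmx p u x))`_L =
    \sum_(L < p - M) tail L * zeta_term u x L.
  apply: eq_bigr => L _; have Lp : (L < p)%N by apply: leq_trans (leq_subr M p).
  by rewrite -[val L]/(val (Ordinal Lp)) coef_rVpoly_ord mul_row_stepmx.
transitivity (\sum_(M.+1 <= K < p) tail (p - K)%N * (index_sign [:: x] * zeta_term u x K)).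
  under eq_bigr do rewrite mxE.
  rewrite exchange_big big_geq_mkord [in RHS]big_mkcond mulr_sumr; apply: eq_bigr => K _ /=.
  rewrite -mulr_sumr mxE; case: ifP => _; last by rewrite mul0r mulr0.
  by rewrite mulrACA IHa mulrC.
rewrite -(big_mkord xpredT (fun L => tail L * zeta_term u x L)).
rewrite [in RHS]big_ltn ?subn_gt0 // {2}/tail big_ord0 mul0r add0r.
rewrite big_nat_rev -[M.+1]add1n big_addn; apply: eq_big_nat => K Kp.
have -> : (1 + M + p - (K + M).+1 = p - K)%N by lia.
by rewrite zeta_term_sub ?subKn //; lia.
Qed.

(* The substitution m -> p - m in the indices of [b] turns the condition that they
   exceed those of [a] into the truncation of a product. *)
Lemma sum_pathmx_cat a b :
  index_sign b * \sum_N (origin R p *m pathmx p u (a ++ b)) 0 N =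
  \sum_(N < p) (rVpoly (origin R p *m pathmx p u a) *
                rVpoly (origin R p *m pathmx p u (rev b)))`_N.
Proof.
rewrite sum_coefM pathmx_cat mulmxA.
under [X in _ * X]eq_bigr do rewrite mxE.
rewrite exchange_big mulr_sumr; apply: eq_bigr => M _ /=.
by rewrite -mulr_sumr mulrCA sum_row_pathmx_rev coef_rVpoly_ord.
Qed.

End Reflection.

(** * Sums over families of blocks *)

Section FfunCat.
Variables (T : Type) (s t : nat).
Implicit Types (f : {ffun 'I_s -> T}) (g : {ffun 'I_t -> T}).

Definition ffun_cat f g : {ffun 'I_(s + t) -> T} :=
  [ffun l => match fintype.split l with inl i => f i | inr j => g j end].

Lemma ffun_cat_lshift f g i : ffun_cat f g (lshift t i) = f i.
Proof. by rewrite ffunE (unsplitK (inl i)). Qed.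

Lemma ffun_cat_rshift f g j : ffun_cat f g (rshift s j) = g j.
Proof. by rewrite ffunE (unsplitK (inr j)). Qed.

Lemma ffun_cat_restr (h : {ffun 'I_(s + t) -> T}) :
  ffun_cat [ffun i => h (lshift t i)] [ffun j => h (rshift s j)] = h.
Proof.
by apply/ffunP => l; case: (split_ordP l) => i ->;
  rewrite ?ffun_cat_lshift ?ffun_cat_rshift ffunE.
Qed.

Lemma ffun_cat_inj f f' g g' : ffun_cat f g = ffun_cat f' g' -> f = f' /\ g = g'.
Proof.
move=> e; split; apply/ffunP => i.
  by rewrite -(ffun_cat_lshift f g) e ffun_cat_lshift.
by rewrite -(ffun_cat_rshift f g) e ffun_cat_rshift.
Qed.

End FfunCat.

Lemma big_fset_set_cat (R : nmodType) (T : choiceType) s t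
    (A : set {ffun 'I_(s + t) -> T}) (A1 : set {ffun 'I_s -> T}) (A2 : set {ffun 'I_t -> T})
    (P : pred {ffun 'I_(s + t) -> T}) (F : {ffun 'I_(s + t) -> T} -> R) :
  finite_set A -> finite_set A1 -> finite_set A2 ->
  (forall f g, A (ffun_cat f g) /\ P (ffun_cat f g) <-> A1 f /\ A2 g) ->
  \sum_(h <- fset_set A | P h) F h =
  \sum_(f <- fset_set A1) \sum_(g <- fset_set A2) F (ffun_cat f g).
Proof.
move=> finA finA1 finA2 AE.
transitivity (\sum_(h <- [seq ffun_cat fg.1 fg.2 |
    fg <- [seq (f, g) | f <- fset_set A1, g <- fset_set A2]]) F h); last first.
  by rewrite big_map big_allpairs.
rewrite -big_filter; apply: perm_big; apply: uniq_perm => [||h]; first by rewrite filter_uniq.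
  rewrite map_inj_uniq; first by apply: allpairs_uniq => // -[? ?] [? ?].
  by move=> [f g] [f' g'] /= /ffun_cat_inj[-> ->].
rewrite mem_filter -[h]ffun_cat_restr; move: [ffun _ => _] [ffun _ => _] => g f.
rewrite in_fset_set //; apply/andP/mapP => [[Ph]|[[f' g'] /allpairsP[[f1 g1] [/= + +]]]].
  rewrite inE => Ah; have [A1f A2g] := (AE f g).1 (conj Ah Ph).
  by exists (f, g) => //; apply: allpairs_f; rewrite in_fset_set // inE.
rewrite !in_fset_set // !inE => A1f A2g [-> ->] /= /ffun_cat_inj[-> ->].
by have [Ah Ph] := (AE f1 g1).2 (conj A1f A2g); split=> //; apply: mem_set.
Qed.

Lemma big_Zset_cat (R : nmodType) s t n (F : {ffun 'I_(s + t) -> nat} -> R) :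
  \sum_(r <- fset_set (Zset (s + t) n)) F r =
  \sum_(i < n.+1) \sum_(r1 <- fset_set (Zset s i))
    \sum_(r2 <- fset_set (Zset t (n - i))) F (ffun_cat r1 r2).
Proof.
pose head_sum (r : {ffun 'I_(s + t) -> nat}) := (\sum_(i < s) r (lshift t i))%N.
rewrite (partition_big (fun r => inord (head_sum r) : 'I_n.+1) xpredT) //=.
apply: eq_bigr => i _; apply: big_fset_set_cat; try exact: finite_Zset.
move=> r1 r2; rewrite /Zset /= /head_sum big_split_ord /=.
under [X in (X + _)%N]eq_bigr do rewrite ffun_cat_lshift.
under [X in (_ + X)%N]eq_bigr do rewrite ffun_cat_rshift.
under [X in inord X]eq_bigr do rewrite ffun_cat_lshift.
split=> [[sumE /eqP iE]|[-> ->]].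
  have {}iE : (\sum_l r1 l)%N = i by rewrite -iE inordK // ltnS -sumE leq_addr.
  by split=> //; rewrite -iE -{1}sumE addKn.
split; first by rewrite subnKC // -ltnS.
by apply/eqP; apply: val_inj; rewrite /= inordK.
Qed.

Lemma big_Sprod_cat (R : nmodType) s t (r1 k1 : {ffun 'I_s -> nat})
    (r2 k2 : {ffun 'I_t -> nat}) (F : {ffun 'I_(s + t) -> seq nzint} -> R) :
  \sum_(a <- fset_set (Sprod (ffun_cat r1 r2) (ffun_cat k1 k2))) F a =
  \sum_(a1 <- fset_set (Sprod r1 k1)) \sum_(a2 <- fset_set (Sprod r2 k2))
     F (ffun_cat a1 a2).
Proof.
apply: big_fset_set_cat; try exact: finite_Sprod.
move=> a1 a2; rewrite /Sprod /=; split=> [[Sa _]|[S1 S2]].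
  split=> l; first by have := Sa (lshift t l); rewrite !ffun_cat_lshift.
  by have := Sa (rshift s l); rewrite !ffun_cat_rshift.
by split=> // l; case: (split_ordP l) => i ->; rewrite ?ffun_cat_lshift ?ffun_cat_rshift.
Qed.

Lemma ffun_ord0 (T : Type) (f g : {ffun 'I_0 -> T}) : f = g.
Proof. by apply/ffunP => -[]. Qed.

Lemma fset_set_Zset0 n :
  fset_set (Zset 0 n) = (if n is 0 then [fset [ffun => 0%N]] else fset0)%fset.
Proof.
have -> : Zset 0 n = if n is 0 then [set [ffun => 0%N]]%classic else classical_sets.set0.
  by apply/seteqP; split=> r; rewrite /Zset /= big_ord0; case: n => // _; apply: ffun_ord0.
by case: n => [|n]; rewrite ?fset_set1 ?fset_set0.
Qed.

Lemma fset_set_Sprod0 (r k : {ffun 'I_0 -> nat}) :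
  fset_set (Sprod r k) = [fset [ffun => [::]]]%fset.
Proof.
have -> : Sprod r k = [set [ffun => [::]]]%classic.
  by apply/seteqP; split=> [a _|a _ []]; first exact: ffun_ord0.
by rewrite fset_set1.
Qed.

Lemma fset_set_Zset1 n : fset_set (Zset 1 n) = [fset [ffun => n]]%fset.
Proof.
have -> : Zset 1 n = [set [ffun => n]]%classic; last by rewrite fset_set1.
apply/seteqP; split=> r; rewrite /Zset /= big_ord1 => rE; last by rewrite rE ffunE.
by apply/ffunP => l; rewrite ffunE ord1.
Qed.

Lemma big_Sprod1 (R : nmodType) i j (F : {ffun 'I_1 -> seq nzint} -> R) :
  \sum_(a <- fset_set (Sprod [ffun => i] [ffun => j])) F a =
  \sum_(b <- fset_set (Ssgn i j)) F [ffun => b].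
Proof.
pose single (b : seq nzint) : {ffun 'I_1 -> seq nzint} := [ffun => b].
have -> : Sprod [ffun => i] [ffun => j] = (single @` Ssgn i j)%classic.
  apply/seteqP; split=> [a /(_ ord0)|_ [b Sb <-] l]; rewrite !ffunE // => Sa.
  by exists (a ord0) => //; apply/ffunP => l; rewrite ffunE [l]ord1.
rewrite fset_set_image ?big_imfset //=; last exact: finite_Ssgn.
by move=> b c _ _ /ffunP/(_ ord0); rewrite !ffunE.
Qed.

Section BlockSums.
Variable R : comNzRingType.

Definition block_sum (V : lmodType R) N n m (x y : 'I_N -> R)
    (Phi : {ffun 'I_N -> seq nzint} -> V) : V :=
  \sum_(r <- fset_set (Zset N n)) \sum_(k <- fset_set (Zset N m))
    (\prod_(l < N) (x l ^+ r l * y l ^+ k l)) *: \sum_(a <- fset_set (Sprod r k)) Phi a.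

Lemma linear_block_sum (V W : lmodType R) (f : {linear V -> W}) N n m (x y : 'I_N -> R) Phi :
  f (block_sum n m x y Phi) = block_sum n m x y (f \o Phi).
Proof.
rewrite linear_sum; apply: eq_bigr => r _; rewrite linear_sum; apply: eq_bigr => k _.
by rewrite linearZ linear_sum.
Qed.

Lemma eq_block_sum (V : lmodType R) N n m (x y : 'I_N -> R)
    (Phi Psi : {ffun 'I_N -> seq nzint} -> V) :
  Phi =1 Psi -> block_sum n m x y Phi = block_sum n m x y Psi.
Proof. by move=> /funext->. Qed.

Lemma block_sum_cat (V : lmodType R) s t n m (x y : 'I_(s + t) -> R)
    (Phi : {ffun 'I_(s + t) -> seq nzint} -> V) :
  block_sum n m x y Phi = \sum_(i < n.+1) \sum_(j < m.+1)
    block_sum i j (x \o @lshift s t) (y \o @lshift s t) (fun a1 =>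
      block_sum (n - i) (m - j) (x \o @rshift s t) (y \o @rshift s t) (fun a2 =>
        Phi (ffun_cat a1 a2))).
Proof.
rewrite /block_sum big_Zset_cat; apply: eq_bigr => i _.
under eq_bigr => r1 _.
  under eq_bigr => r2 _ do rewrite big_Zset_cat.
  rewrite exchange_big /=; over.
rewrite exchange_big; apply: eq_bigr => j _.
apply: eq_bigr => r1 _; rewrite exchange_big; apply: eq_bigr => k1 _ /=.
rewrite [in RHS]exchange_big scaler_sumr; apply: eq_bigr => r2 _.
rewrite [in RHS]exchange_big scaler_sumr; apply: eq_bigr => k2 _.
rewrite -scaler_sumr big_Sprod_cat scalerA; congr (_ *: _).
by rewrite big_split_ord; congr (_ * _); apply: eq_bigr => l _;
  rewrite /= ?ffun_cat_lshift ?ffun_cat_rshift.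
Qed.

Lemma block_sum0 (V : lmodType R) n m (x y : 'I_0 -> R)
    (Phi : {ffun 'I_0 -> seq nzint} -> V) :
  block_sum n m x y Phi = ((n == 0%N) && (m == 0%N))%:R *: Phi [ffun => [::]].
Proof.
rewrite /block_sum !fset_set_Zset0; case: n => [|n]; last by rewrite big_seq_fset0 scale0r.
rewrite big_seq_fset1; case: m => [|m]; last by rewrite big_seq_fset0 scale0r.
by rewrite big_seq_fset1 big_ord0 fset_set_Sprod0 big_seq_fset1.
Qed.

Lemma block_sum1 (V : lmodType R) n m (x y : 'I_1 -> R)
    (Phi : {ffun 'I_1 -> seq nzint} -> V) :
  block_sum n m x y Phi =
  (x ord0 ^+ n * y ord0 ^+ m) *: \sum_(b <- fset_set (Ssgn n m)) Phi [ffun => b].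
Proof. by rewrite /block_sum !fset_set_Zset1 !big_seq_fset1 big_ord1 !ffunE big_Sprod1. Qed.

Definition coefmx p i j (M : 'M[fps (fps R)]_p) : 'M[R]_p :=
  map_mx (fpscoef j) (map_mx (fpscoef i) M).

Lemma coefmx1 p i j : coefmx i j (1%:M : 'M_p) = ((i == 0%N) && (j == 0%N))%:R *: 1%:M.
Proof.
apply/matrixP => k l; rewrite !mxE; case: (k == l); rewrite /= ?mulr0 // mulr1n mulr1.
by case: i => [|i].
Qed.

Lemma coefmxM p n m (M M' : 'M[fps (fps R)]_p) : coefmx n m (M *m M') =
  \sum_(i < n.+1) \sum_(j < m.+1) coefmx i j M *m coefmx (n - i) (m - j) M'.
Proof.
by rewrite /coefmx map_fpscoefM raddf_sum; apply: eq_bigr => i _; apply: map_fpscoefM.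
Qed.

Lemma block_sum_prod p (G : seq nzint -> 'M[R]_p) N n m (x y : 'I_N -> R)
    (B : 'I_N -> 'M[fps (fps R)]_p) :
  (forall l i j, coefmx i j (B l) =
    (x l ^+ i * y l ^+ j) *: \sum_(b <- fset_set (Ssgn i j)) G b) ->
  block_sum n m x y (fun a => \prod_(l < N) G (a l)) = coefmx n m (\prod_(l < N) B l).
Proof.
elim: N n m x y B => [|N IHN] n m x y B BE.
  by rewrite block_sum0 !big_ord0 coefmx1.
rewrite (@block_sum_cat _ 1 N) (@big_split_ord _ _ _ 1 N) big_ord1 coefmxM.
apply: eq_bigr => i _; apply: eq_bigr => j _.
rewrite block_sum1 BE -scalemxAl mulmx_suml; congr (_ *: _); apply: eq_bigr => b _.
rewrite -(IHN _ _ (x \o @rshift 1 N) (y \o @rshift 1 N)) => [|l i' j']; last by rewrite BE.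
rewrite (linear_block_sum (mulmx (G b))); apply: eq_block_sum => a.
rewrite (@big_split_ord _ _ _ 1 N) big_ord1; congr (_ * _).
  by congr (G _); apply: etrans (ffun_cat_lshift _ _ _) _; rewrite ffunE.
by apply: eq_bigr => l _; congr (G _); apply: ffun_cat_rshift.
Qed.

End BlockSums.

(** * Generating series of blocks *)

Fact signed_neq0 (e : bool) (d : nat) : (if e then Negz d else Posz d.+1) != 0.
Proof. by case: e. Qed.

Definition signed_nz (e : bool) (d : nat) : nzint :=
  exist (fun a : int => a != 0) _ (signed_neq0 e d).

Lemma absz_signed_nz e d : `|val (signed_nz e d)|%N = d.+1.
Proof. by case: e. Qed.

Lemma signed_nz_inj d : injective (signed_nz^~ d).
Proof. by move=> e e' /(congr1 val); case: e e' => -[]. Qed.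

Lemma signed_nzE (x : nzint) : x = signed_nz (val x < 0) `|val x|.-1.
Proof. by apply: val_inj; case: x => -[[|d]|d]. Qed.

Lemma mem_Ssgn i j a :
  (a \in fset_set (Ssgn i j)) = (size a == i.+1) && (weight a == (i + j).+1).
Proof.
rewrite in_fset_set; last exact: finite_Ssgn.
apply/idP/andP; rewrite inE /Ssgn /= addn1; first by case=> -> ->.
by case=> /eqP-> /eqP->.
Qed.

Lemma big_Ssgn_rev (R : nmodType) i j (F : seq nzint -> R) :
  \sum_(a <- fset_set (Ssgn i j)) F (rev a) = \sum_(a <- fset_set (Ssgn i j)) F a.
Proof.
rewrite -(big_map rev xpredT F); apply: perm_big; apply: uniq_perm => [||a].
- by rewrite (map_inj_uniq (can_inj revK)) fset_uniq.
- exact: fset_uniq.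
rewrite -{1}[a]revK (mem_map (can_inj revK)) !mem_Ssgn size_rev.
by rewrite /weight (perm_big a) // perm_rev.
Qed.

Lemma big_Ssgn0 (R : nmodType) j (F : seq nzint -> R) :
  \sum_(a <- fset_set (Ssgn 0 j)) F a = \sum_(e : bool) F [:: signed_nz e j].
Proof.
rewrite -(big_map (fun e => [:: signed_nz e j]) xpredT F).
apply: perm_big; apply: uniq_perm => [||a]; first exact: fset_uniq.
  rewrite map_inj_uniq ?index_enum_uniq // => e e'.
  by move/(congr1 (last (signed_nz e j)))/signed_nz_inj.
rewrite mem_Ssgn; apply/andP/mapP => [[]|[e _ ->]].
  case: a => [|x []] // _; rewrite /weight big_seq1 => /eqP wx.
  by exists (val x < 0); rewrite ?mem_index_enum // {1}[x]signed_nzE wx.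
by rewrite /weight big_seq1 absz_signed_nz.
Qed.

Lemma big_SsgnS (R : nmodType) i j (F : seq nzint -> R) :
  \sum_(a <- fset_set (Ssgn i.+1 j)) F a =
  \sum_(d < j.+1) \sum_(a <- fset_set (Ssgn i d)) \sum_(e : bool)
    F (rcons a (signed_nz e (j - d))).
Proof.
pose excess_init (a : seq nzint) := (j - `|val (last (signed_nz false 0) a)|.-1)%N.
rewrite (partition_big (fun a => inord (excess_init a) : 'I_j.+1) xpredT) //=.
apply: eq_bigr => d _.
transitivity (\sum_(a <- [seq rcons b (signed_nz e (j - d)) |
    b <- fset_set (Ssgn i d), e <- index_enum bool]) F a); last by rewrite big_allpairs_dep.
rewrite -big_filter; apply: perm_big; apply: uniq_perm => [||a].
- exact: filter_uniq (fset_uniq _).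
- apply: allpairs_uniq; rewrite ?fset_uniq ?index_enum_uniq // => -[b e] [b' e'] _ _ /=.
  move/rcons_inj=> eq_be; congr (_, _); first by case: eq_be.
  exact: (signed_nz_inj (congr1 snd eq_be)).
rewrite mem_filter mem_Ssgn /excess_init; apply/and3P/allpairsP => [[]|[[b e] /= []]].
  case/lastP: a => [|b x] //; rewrite last_rcons size_rcons weight_rcons => /eqP dE.
  have {}dE : (j - `|val x|.-1)%N = d by rewrite -dE inordK // ltnS leq_subr.
  have := size_le_weight b; have : (0 < `|val x|)%N by rewrite absz_gt0 (valP x).
  move=> x_gt0 le_b /eqP[sb] wb; exists (b, val x < 0).
  rewrite /= mem_index_enum mem_Ssgn sb eqxx {1}[x]signed_nzE -dE.
  move: (`|val x|)%N (weight b) x_gt0 le_b wb; rewrite sb => y w y_gt0 le_w wy.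
  by split=> //; [lia | congr (rcons b (signed_nz _ _)); lia].
rewrite mem_Ssgn => /andP[/eqP sb /eqP wb] _ ->.
rewrite last_rcons size_rcons weight_rcons absz_signed_nz sb wb; have := ltn_ord d.
split; [|by []|by lia].
by apply/eqP/val_inj; rewrite /= inordK; lia.
Qed.

Section GeneratingSeries.
Variables (R : comNzRingType) (p : nat) (u : nat -> R).
Hypothesis p_gt0 : (0 < p)%N.
Hypothesis u_inv : forall N, (0 < N < p)%N -> u N * N%:R = 1.

(* The steps of all exponents: the two signs cancel for odd j, and the powers of 1/j, the
   (d+1)-st one weighted by (y Y)^d, add up to 1/(j - y Y). *)
Definition step_series (y : R) : 'M[fps R]_p :=
  \matrix_(i, j) if (i < j)%N && ~~ odd j then 2%:R * fps_geom (u j) y else 0.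

Lemma sum_stepmx d : \sum_(e : bool) stepmx p u (signed_nz e d) =
  \matrix_(i, j) if (i < j)%N && ~~ odd j then 2%:R * u j ^+ d.+1 else 0.
Proof.
apply/matrixP => i j; rewrite summxE big_bool !mxE; case: (i < j)%N; last exact: addr0.
rewrite /zeta_term /= (_ : sgz (Negz d) = -1) // (_ : sgz (Posz d.+1) = 1) //.
rewrite expr1n -mulrDl mulrN1z -signr_odd.
by case: (odd j); rewrite ?expr1 ?addNr ?mul0r.
Qed.

Lemma coef_step_series y d : map_mx (fpscoef d) (step_series y) =
  y ^+ d *: \sum_(e : bool) stepmx p u (signed_nz e d).
Proof.
rewrite sum_stepmx; apply/matrixP => i j; rewrite !mxE; case: ifP => _; last by rewrite mulr0.
by rewrite !mulr_natl /fpscoef /= mulrnAr mulrC.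
Qed.

Lemma coef_step_series_exp y i j : map_mx (fpscoef j) (step_series y ^+ i.+1) =
  y ^+ j *: \sum_(b <- fset_set (Ssgn i j)) pathmx p u b.
Proof.
elim: i j => [|i IHi] j.
  rewrite expr1 coef_step_series big_Ssgn0; congr (_ *: _).
  by apply: eq_bigr => e _; rewrite /pathmx big_seq1.
rewrite exprSr map_fpscoefM big_SsgnS scaler_sumr; apply: eq_bigr => d _.
rewrite IHi coef_step_series -scalemxAl -scalemxAr scalerA -exprD subnKC; last by rewrite -ltnS.
congr (_ *: _); rewrite mulmx_suml; apply: eq_bigr => b _.
by rewrite mulmx_sumr; apply: eq_bigr => e _; rewrite pathmx_rcons.
Qed.

(* In [fps (fps R)] the outer variable X marks the depth of a block minus one, the
   exponent of lambda, and the inner variable Y its weight minus its depth, the exponent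
   of mu; [v] is the pair (lambda, mu). *)
Definition block_series (v : R * R) : 'M[fps (fps R)]_p :=
  \matrix_(i, j) Fps (fun n => fpsC (v.1 ^+ n) * (step_series v.2 ^+ n.+1) i j).

Lemma map_fpscoef_block_series v n :
  map_mx (fpscoef n) (block_series v) = fpsC v.1 ^+ n *: step_series v.2 ^+ n.+1.
Proof. by apply/matrixP => i j; rewrite !mxE -rmorphXn. Qed.

Lemma coef_block_series v i j : coefmx i j (block_series v) =
  (v.1 ^+ i * v.2 ^+ j) *: \sum_(b <- fset_set (Ssgn i j)) pathmx p u b.
Proof.
rewrite -scalerA -coef_step_series_exp /coefmx map_fpscoef_block_series -rmorphXn.
by apply/matrixP => k l; rewrite !mxE; apply: coef_fpsCM.
Qed.

Definition depth_coef (v : R * R) : fps (fps R) := fpsC (fpsC v.1) * fpsX (fps R).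
Definition weight_coef (v : R * R) : fps (fps R) := fpsC (fpsC v.2 * fpsX R).

Fact depth_coef_is_additive : zmod_morphism depth_coef.
Proof. by move=> v w; rewrite /depth_coef !rmorphB mulrBl. Qed.
HB.instance Definition _ :=
  GRing.isZmodMorphism.Build _ (fps (fps R)) depth_coef depth_coef_is_additive.

Fact weight_coef_is_additive : zmod_morphism weight_coef.
Proof. by move=> v w; rewrite /weight_coef !rmorphB mulrBl rmorphB. Qed.
HB.instance Definition _ :=
  GRing.isZmodMorphism.Build _ (fps (fps R)) weight_coef weight_coef_is_additive.

Lemma block_series_rec v : block_series v =
  (1%:M + depth_coef v *: block_series v) *m map_mx (@fpsC _) (step_series v.2).
Proof.
apply: fps_mxP => n; rewrite map_fpscoef_mulC map_fpscoef_block_series.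
have -> : map_mx (fpscoef n) (1%:M + depth_coef v *: block_series v) =
    fpsC v.1 ^+ n *: step_series v.2 ^+ n; last by rewrite -scalemxAl exprSr.
have coef_scaled : map_mx (fpscoef n) (depth_coef v *: block_series v) =
    if n is n'.+1 then fpsC v.1 *: map_mx (fpscoef n') (block_series v) else 0.
  apply/matrixP => i j; rewrite !mxE /fpscoef /depth_coef -mulrA coef_fpsCM coef_fpsXM.
  by case: (n) => [|n']; rewrite !mxE ?mulr0.
have coef_unit : map_mx (fpscoef n) (1%:M : 'M[fps (fps R)]_p) = (n == 0%N)%:R%:M.
  by apply/matrixP => i j; rewrite !mxE; case: eqP => _; rewrite ?mulr0n ?mulr1n.
rewrite map_mxD coef_scaled coef_unit; case: n {coef_scaled coef_unit} => [|n].
  by rewrite addr0 !expr0 scale1r.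
by rewrite map_fpscoef_block_series scalerA -exprS raddf0 add0r.
Qed.

Lemma row_step_series (w : 'rV[fps (fps R)]_p) y (N : 'I_p) :
  (w *m map_mx (@fpsC _) (step_series y)) 0 N =
  if odd N then 0 else fpsC (2%:R * fps_geom (u N) y) * \sum_(M < N) (rVpoly w)`_M.
Proof.
rewrite (big_ord_widen _ (fun M => (rVpoly w)`_M) (ltnW (ltn_ord N))) !mxE mulr_sumr.
rewrite [X in if _ then _ else X]big_mkcond.
case: ifPn => oddN.
  by rewrite big1 // => M _; rewrite !mxE oddN andbF rmorph0 mulr0.
apply: eq_bigr => M _; rewrite coef_rVpoly_ord !mxE oddN andbT.
by case: ifP => _; rewrite ?rmorph0 ?mulr0 // mulrC.
Qed.

Fixpoint block_row (v : nat -> R * R) (k : nat) : 'rV[fps (fps R)]_p :=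
  if k is k'.+1 then block_row v k' *m block_series (v k') else origin _ p.

Lemma block_rowE v k : block_row v k = origin _ p *m \prod_(l < k) block_series (v l).
Proof.
elim: k => [|k IHk]; first by rewrite big_ord0 mulmx1.
by rewrite big_ord_recr mulmxA -IHk.
Qed.

Lemma block_rowS v k : block_row v k.+1 =
  (block_row v k + depth_coef (v k) *: block_row v k.+1) *m
    map_mx (@fpsC _) (step_series (v k).2).
Proof. by rewrite /= {1}block_series_rec mulmxA mulmxDr mulmx1 -scalemxAr. Qed.

Definition block_poly v k : {poly fps (fps R)} := rVpoly (block_row v k).

Lemma eq_block_poly v w k : (forall i, (i < k)%N -> v i = w i) -> block_poly v k = block_poly w k.
Proof.
move=> vw; have rowE : block_row v k = block_row w k.
  elim: k vw => [|k IHk] vw /=; first by [].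
  by rewrite (vw k (ltnSn k)) IHk // => i ik; apply: vw; apply: ltnW.
by rewrite /block_poly rowE.
Qed.

Lemma block_poly0 v : block_poly v 0 = 1.
Proof. exact: rVpoly_origin. Qed.

Lemma coef_block_polyS v k N : (N < p)%N -> (block_poly v k.+1)`_N =
  if odd N then 0 else fpsC (2%:R * fps_geom (u N) (v k).2) *
    \sum_(M < N) (depth_coef (v k) *: block_poly v k.+1 + block_poly v k)`_M.
Proof.
move=> Np; rewrite -[N]/(val (Ordinal Np)) coef_rVpoly_ord block_rowS row_step_series.
by rewrite linearD linearZ addrC.
Qed.

Lemma block_polyS_coef0 v k : (block_poly v k.+1)`_0 = 0.
Proof. by rewrite coef_block_polyS // big_ord0 mulr0. Qed.

Lemma block_poly_odd v k N : odd N -> (block_poly v k)`_N = 0.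
Proof.
case: (ltnP N p) => [Np|le_pN] oddN; last first.
  by rewrite coef_rVpoly insubF // ltnNge le_pN.
case: k => [|k]; last by rewrite coef_block_polyS // oddN.
by rewrite block_poly0 coef1; case: N oddN {Np}.
Qed.

(* 2 z^2 / (1 - z^2), truncated. *)
Definition even_series : {poly fps (fps R)} :=
  \poly_(N < p) (if odd N || (N == 0%N) then 0 else 2%:R).

Lemma coef_even_seriesM (F : {poly fps (fps R)}) N :
  (N < p)%N -> (forall M, odd M -> F`_M = 0) ->
  (even_series * F)`_N = if odd N then 0 else 2%:R * \sum_(M < N) F`_M.
Proof.
move=> Np F_odd; rewrite mulrC coefM big_ord_recr /= subnn coef_poly p_gt0 mulr0 addr0.
have coefE (M : 'I_N) : F`_M * even_series`_(N - M) = if odd N then 0 else 2%:R * F`_M.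
  have [ltMN [/F_odd FM0|evM]] := (ltn_ord M, boolP (odd M)).
    by rewrite FM0 mul0r mulr0 if_same.
  rewrite coef_poly (leq_ltn_trans (leq_subr M N) Np) oddB ?(ltnW ltMN) // (negbTE evM).
  by rewrite subn_eq0 leqNgt ltMN orbF addbF; case: ifP => _; rewrite ?mulr0 // mulrC.
under eq_bigr do rewrite coefE.
by case: (odd N); [rewrite big1 | rewrite mulr_sumr].
Qed.

Lemma geom_weight_coefK v N : (0 < N < p)%N ->
  (N%:R - weight_coef v) * fpsC (fps_geom (u N) v.2) = 1.
Proof.
move=> Np; rewrite /weight_coef -(rmorph_nat (@fpsC (fps R))) -rmorphB -rmorphM.
by rewrite -(rmorph_nat (@fpsC R)) fps_geomK ?rmorph1 ?u_inv.
Qed.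

Lemma weight_coef_reg v N : (0 < N < p)%N -> GRing.lreg (N%:R - weight_coef v).
Proof.
move=> Np; apply: (can_inj (g := *%R (fpsC (fps_geom (u N) v.2)))) => f.
by rewrite mulrA [X in X * f]mulrC geom_weight_coefK // mul1r.
Qed.

Lemma block_poly_ode v k :
  ode_solution p even_series (depth_coef (v k)) (weight_coef (v k))
    (block_poly v k) (block_poly v k.+1).
Proof.
move=> N Np; rewrite coef_X_deriv coefD coefCM mul_polyC.
rewrite coef_even_seriesM // => [|M oddM]; last first.
  by rewrite coefD coefZ !block_poly_odd // mulr0 addr0.
apply/eqP; rewrite -subr_eq0 opprD addrA -mulrBl subr_eq0; apply/eqP.
rewrite coef_block_polyS //; case: ifP => _; first by rewrite mulr0.
case: (posnP N) => [->|N_gt0]; first by rewrite !big_ord0 !mulr0.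
rewrite rmorphM rmorph_nat mulrA [2 * _]mulrC mulrA geom_weight_coefK ?mul1r //.
by rewrite N_gt0.
Qed.

End GeneratingSeries.

(** * The identity for one odd prime *)

Section TruncatedProduct.
Variables (R : comNzRingType) (p : nat).
Implicit Types M : 'M[R]_p.

Definition trunc_pairing M M' : R^o :=
  \sum_(N < p) (rVpoly (origin R p *m M) * rVpoly (origin R p *m M'))`_N.

Fact trunc_pairing_is_linear M : linear (trunc_pairing M).
Proof.
move=> c M1 M2; rewrite /trunc_pairing scaler_sumr -big_split; apply: eq_bigr => N _ /=.
by rewrite mulmxDr -scalemxAr linearP mulrDr -scalerAr coefD coefZ.
Qed.
HB.instance Definition _ M :=
  GRing.isLinear.Build R 'M[R]_p R^o *:%R (trunc_pairing M) (trunc_pairing_is_linear M).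

Lemma trunc_pairingC M M' : trunc_pairing M M' = trunc_pairing M' M.
Proof. by apply: eq_bigr => N _; rewrite mulrC. Qed.

Lemma trunc_pairing1 M : (0 < p)%N -> trunc_pairing 1%:M M = \sum_j (origin R p *m M) 0 j.
Proof.
by move=> p_gt0; rewrite -sum_rVpoly; apply: eq_bigr => N _; rewrite mulmx1 rVpoly_origin ?mul1r.
Qed.

End TruncatedProduct.

Section CoefBlockPoly.
Variables (R : comNzRingType) (p : nat) (u : nat -> R).
Hypothesis p_gt0 : (0 < p)%N.
Implicit Types v w : nat -> R * R.

Lemma coef_block_poly v k N i j : (block_poly p u v k)`_N i j =
  (rVpoly (origin R p *m coefmx i j (\prod_(l < k) block_series p u (v l))))`_N.
Proof.
rewrite /block_poly block_rowE !coef_rVpoly; case: insubP => [L _ _|//].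
by rewrite !(mul_origin _ (i := Ordinal p_gt0)) // !mxE.
Qed.

Lemma sum_coef_block_poly v k n m : \sum_(N < p) (block_poly p u v k)`_N n m =
  trunc_pairing 1%:M (coefmx n m (\prod_(l < k) block_series p u (v l))).
Proof.
by apply: eq_bigr => N _; rewrite coef_block_poly mulmx1 rVpoly_origin // mul1r.
Qed.

Lemma sum_coef_block_polyM v w k l n m :
  \sum_(N < p) (block_poly p u v k * block_poly p u w l)`_N n m =
  \sum_(i < n.+1) \sum_(j < m.+1)
    trunc_pairing (coefmx i j (\prod_(h < k) block_series p u (v h)))
                  (coefmx (n - i) (m - j) (\prod_(h < l) block_series p u (w h))).
Proof.
rewrite /trunc_pairing; under [RHS]eq_bigr do rewrite exchange_big.
rewrite exchange_big; apply: eq_bigr => N _ /=.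
under [RHS]eq_bigr do under eq_bigr do rewrite coefM.
under [RHS]eq_bigr do rewrite exchange_big.
rewrite coefM !coef_fps_sum [RHS]exchange_big; apply: eq_bigr => M _ /=.
rewrite coef_fps_sum; apply: eq_bigr => i _; rewrite coef_fpsM.
by apply: eq_bigr => j _; rewrite !coef_block_poly.
Qed.

End CoefBlockPoly.

Definition nat_ext (T : Type) (x0 : T) N (x : 'I_N -> T) (i : nat) : T :=
  oapp x x0 (insub i).

Lemma nat_extE (T : Type) (x0 : T) N (x : 'I_N -> T) (i : 'I_N) : nat_ext x0 x i = x i.
Proof. by rewrite /nat_ext valK. Qed.

Section BlockSumPaths.
Variables (R : comNzRingType) (p : nat) (u : nat -> R).

Lemma block_sum_pathmx N n m (x y : 'I_N -> R) (v : nat -> R * R) :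
  (forall l : 'I_N, v l = (x l, y l)) ->
  block_sum n m x y (fun a => \prod_(l < N) pathmx p u (a l)) =
  coefmx n m (\prod_(l < N) block_series p u (v l)).
Proof.
by move=> vE; apply: block_sum_prod => l i j; rewrite vE coef_block_series.
Qed.

Lemma block_sum_pathmx_rev N n m (x y : 'I_N -> R) (v : nat -> R * R) :
  (forall l : 'I_N, v l = (x l, y l)) ->
  block_sum n m x y (fun a => \prod_(l < N) pathmx p u (rev (a l))) =
  coefmx n m (\prod_(l < N) block_series p u (v l)).
Proof.
move=> vE; apply: (block_sum_prod (G := fun a => pathmx p u (rev a))) => l i j.
by rewrite vE coef_block_series big_Ssgn_rev.
Qed.

End BlockSumPaths.

Section BothSums.
Variables (s t n m : nat).

Definition reversed_sum (R : comNzRingType) (x y : 'I_(s + t) -> R) (z : seq nzint -> R) : R :=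
  \sum_(r <- fset_set (Zset (s + t) n)) \sum_(k <- fset_set (Zset (s + t) m))
     (-1) ^+ q_exp r k * (\prod_(l < s + t) (x l ^+ r l * y l ^+ k l))
     * \sum_(a <- fset_set (Sprod r k))
          (\prod_(v < t) sgn (a (rshift s v)))%:~R * z (concat_rev a).

Definition shuffle_sum (R : comNzRingType) (x y : 'I_(s + t) -> R) (z : seq nzint -> R) : R :=
  \sum_(sigma in Wset s t)
    \sum_(r <- fset_set (Zset (s + t) n)) \sum_(k <- fset_set (Zset (s + t) m))
     (\prod_(l < s + t) (Pform sigma x l ^+ r l * Pform sigma y l ^+ k l))
     * \sum_(a <- fset_set (Sprod r k)) z (concat a).

End BothSums.

Lemma Pform_pair (U V : nmodType) s t (sigma : 'S_(s + t)) (x : 'I_(s + t) -> U)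
    (y : 'I_(s + t) -> V) i :
  Pform sigma (fun l => (x l, y l)) i = (Pform sigma x i, Pform sigma y i).
Proof. by rewrite /Pform; elim/big_rec3: _ => //= j a b c _ ->. Qed.

Section OddPrime.
Variables (R : comNzRingType) (p : nat) (u : nat -> R) (zeta : seq nzint -> R).
Hypotheses (p_odd : odd p) (p_eq0 : p%:R = 0 :> R).
Hypothesis u_inv : forall N, (0 < N < p)%N -> u N * N%:R = 1.
Hypothesis zetaE : forall a, zeta a = \sum_j (origin R p *m pathmx p u a) 0 j.
Variables (s t n m : nat) (x y : 'I_(s + t) -> R).

Let p_gt0 : (0 < p)%N. Proof. by rewrite odd_gt0. Qed.
Let left_labels := nat_ext 0 (fun i : 'I_s => (x (lshift t i), y (lshift t i))).
Let right_labels := nat_ext 0 (fun j : 'I_t => (x (rshift s j), y (rshift s j))).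

Lemma q_exp_weight (r k : {ffun 'I_(s + t) -> nat}) (a : {ffun 'I_(s + t) -> seq nzint}) :
  Sprod r k a -> q_exp r k = (\sum_(j < t) weight (a (rshift s j)))%N.
Proof.
move=> Sa; rewrite /q_exp -[X in (_ + X)%N]card_ord -sum1_card -big_split.
by apply: eq_bigr => j _; have [_ ->] := Sa (rshift s j).
Qed.

Lemma zeta_concat_rev (r k : {ffun 'I_(s + t) -> nat}) (a : {ffun 'I_(s + t) -> seq nzint}) :
  Sprod r k a ->
  (-1) ^+ q_exp r k * (\prod_(v < t) sgn (a (rshift s v)))%:~R * zeta (concat_rev a) =
  trunc_pairing (\prod_(i < s) pathmx p u (a (lshift t i)))
                (\prod_(j < t) pathmx p u (rev (a (rshift s j)))).
Proof.
move=> Sa; rewrite zetaE /concat_rev.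
set tail := flatten (rev _).
have -> : (-1) ^+ q_exp r k * (\prod_(v < t) sgn (a (rshift s v)))%:~R = index_sign R tail.
  rewrite /index_sign /weight /sgn !big_flatten !big_rev.
  by rewrite !(big_map (fun v => a (rshift s v))) !big_enum /= (q_exp_weight Sa).
rewrite sum_pathmx_cat // rev_flatten map_rev revK !pathmx_flatten (big_map rev).
by rewrite (big_map (fun l => a (lshift t l))) (big_map (fun v => a (rshift s v))) !big_enumT.
Qed.

Lemma reversed_sum_block_poly : reversed_sum n m x y zeta =
  \sum_(N < p) (block_poly p u left_labels s * block_poly p u right_labels t)`_N n m.
Proof.
transitivity (block_sum n m x y (fun a =>
    trunc_pairing (\prod_(i < s) pathmx p u (a (lshift t i)))
                  (\prod_(j < t) pathmx p u (rev (a (rshift s j)))))).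
  apply: eq_bigr => r _; apply: eq_bigr => k _.
  rewrite -mulrA mulrCA; congr (_ * _); rewrite mulr_sumr.
  apply: eq_big_seq => a; rewrite in_fset_set ?inE; last exact: finite_Sprod.
  by move/zeta_concat_rev => <-; rewrite mulrA.
have leftE (i : 'I_s) : left_labels i = ((x \o @lshift s t) i, (y \o @lshift s t) i).
  exact: nat_extE.
have rightE (j : 'I_t) : right_labels j = ((x \o @rshift s t) j, (y \o @rshift s t) j).
  exact: nat_extE.
rewrite sum_coef_block_polyM // block_sum_cat; apply: eq_bigr => i _; apply: eq_bigr => j _.
rewrite -(block_sum_pathmx p u _ _ leftE) -(block_sum_pathmx_rev p u _ _ rightE).
rewrite trunc_pairingC linear_block_sum; apply: (@eq_block_sum R R^o) => a1 /=.
rewrite trunc_pairingC linear_block_sum; apply: (@eq_block_sum R R^o) => a2 /=.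
by congr trunc_pairing; apply: eq_bigr => l _; rewrite ?ffun_cat_lshift ?ffun_cat_rshift.
Qed.

Lemma block_sum_concat (X Y : 'I_(s + t) -> R) (v : nat -> R * R) :
  (forall l : 'I_(s + t), v l = (X l, Y l)) ->
  \sum_(r <- fset_set (Zset (s + t) n)) \sum_(k <- fset_set (Zset (s + t) m))
     (\prod_(l < s + t) (X l ^+ r l * Y l ^+ k l))
     * \sum_(a <- fset_set (Sprod r k)) zeta (concat a) =
  \sum_(N < p) (block_poly p u v (s + t))`_N n m.
Proof.
move=> vE; rewrite sum_coef_block_poly // -(block_sum_pathmx p u _ _ vE) linear_block_sum.
apply: eq_bigr => r _; apply: eq_bigr => k _; congr (_ * _); apply: eq_bigr => a _.
by rewrite zetaE /= trunc_pairing1 // /concat pathmx_flatten big_map big_enumT.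
Qed.

Lemma shuffle_sum_block_poly : shuffle_sum n m x y zeta =
  \sum_(w : (s + t).-tuple bool | count id w == t)
    \sum_(N < p) (block_poly p u (merge_labels left_labels right_labels w) (s + t))`_N n m.
Proof.
rewrite -(sum_Wset_words (fun w => \sum_(N < p) (block_poly p u (merge_labels _ _ w) _)`_N n m)).
apply: eq_bigr => sigma sW; apply: block_sum_concat => l.
by rewrite -Pform_pair; apply/esym/Pform_merge_labels => // j; apply/esym/nat_extE.
Qed.

Lemma reversed_sum_eq_shuffle_sum : reversed_sum n m x y zeta = shuffle_sum n m x y zeta.
Proof.
rewrite reversed_sum_block_poly shuffle_sum_block_poly exchange_big; apply: eq_bigr => N _ /=.
have even_series0 : (even_series R p)`_0 = 0 by rewrite coef_poly p_gt0.
rewrite (shuffle_product even_series0 (@weight_coef_reg R p u u_inv) (@eq_block_poly R p u)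
  (block_poly0 u p_gt0) (block_polyS_coef0 u p_gt0) (block_poly_ode p_gt0 u_inv)
  _ _ (erefl (s + t)%N) (ltn_ord N)).
by rewrite coef_sum !coef_fps_sum.
Qed.

End OddPrime.

(** * From the finite fields to the quotient ring *)

Section PrimeField.
Variables (p : primeT) (R : comNzRingType) (f : {rmorphism 'F_(val p) -> R}).

Lemma rmorph_zeta_p a : f (zeta_p a p) =
  \sum_j (origin R (val p) *m pathmx (val p) (fun N => f N%:R^-1) a) 0 j.
Proof.
rewrite -sum_nested ?prime_gt0 ?(valP p) // rmorph_sum; apply: eq_bigr => m _.
rewrite rmorph_prod; apply: eq_bigr => i _.
by rewrite /zeta_term rmorphM rmorphXn rmorph_int -exprVn rmorphXn.
Qed.

Lemma odd_prime_sums_eq s t n m (x y : 'I_(s + t) -> R) : odd (val p) ->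
  reversed_sum n m x y (fun a => f (zeta_p a p)) =
  shuffle_sum n m x y (fun a => f (zeta_p a p)).
Proof.
move=> p_odd; have pcharFp := pchar_Fp (valP p).
apply: (reversed_sum_eq_shuffle_sum (u := fun N => f N%:R^-1) p_odd) => //.
- by rewrite -(rmorph_nat f) (pcharf0 pcharFp) rmorph0.
- move=> N /andP[N_gt0 ltNp]; rewrite -(rmorph_nat f) -rmorphM mulVf ?rmorph1 //.
  by rewrite -(dvdn_pcharf pcharFp) gtnNdvd.
- exact: rmorph_zeta_p.
Qed.

End PrimeField.

Lemma rmorph_Pform (R S : pzRingType) (f : {rmorphism R -> S}) s t
    (sigma : 'S_(s + t)) (x : 'I_(s + t) -> R) i :
  f (Pform sigma x i) = Pform sigma (f \o x) i.
Proof. exact: rmorph_sum. Qed.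

Section Functoriality.
Variables (s t n m : nat) (R S : comNzRingType) (f : {rmorphism R -> S}).
Variables (x y : 'I_(s + t) -> R) (z : seq nzint -> R).

Lemma rmorph_reversed_sum :
  f (reversed_sum n m x y z) = reversed_sum n m (f \o x) (f \o y) (f \o z).
Proof.
rewrite rmorph_sum; apply: eq_bigr => r _; rewrite rmorph_sum; apply: eq_bigr => k _.
rewrite !rmorphM rmorph_sum rmorph_prod rmorph_sign; congr (_ * _ * _).
  by apply: eq_bigr => l _; rewrite rmorphM !rmorphXn.
by apply: eq_bigr => a _; rewrite rmorphM rmorph_int.
Qed.

Lemma rmorph_shuffle_sum :
  f (shuffle_sum n m x y z) = shuffle_sum n m (f \o x) (f \o y) (f \o z).
Proof.
rewrite rmorph_sum; apply: eq_bigr => sigma _.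
rewrite rmorph_sum; apply: eq_bigr => r _; rewrite rmorph_sum; apply: eq_bigr => k _.
rewrite rmorphM rmorph_sum rmorph_prod; congr (_ * _).
by apply: eq_bigr => l _; rewrite rmorphM !rmorphXn !rmorph_Pform.
Qed.

End Functoriality.

Definition prod_proj (p : primeT) (f : prodFp) : 'F_(val p) := f p.

Fact prod_proj_is_additive p : zmod_morphism (prod_proj p). Proof. by []. Qed.
Fact prod_proj_is_multiplicative p : monoid_morphism (prod_proj p). Proof. by []. Qed.
HB.instance Definition _ p :=
  GRing.isZmodMorphism.Build prodFp 'F_(val p) (prod_proj p) (prod_proj_is_additive p).
HB.instance Definition _ p :=
  GRing.isMonoidMorphism.Build prodFp 'F_(val p) (prod_proj p) (prod_proj_is_multiplicative p).

Definition calA_proj : {rmorphism prodFp -> calA} := \pi_calA%qT.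

Lemma calA_proj_eq (f g : prodFp) : (forall p : primeT, odd (val p) -> f p = g p) ->
  calA_proj f = calA_proj g.
Proof.
move=> fg; apply/eqP; rewrite -Quotient.idealrBE; apply/asboolP.
apply: (@sub_finite_set _ _ [set exist prime 2%N isT]%classic); last exact: finite_set1.
move=> p /=; rewrite -[(f - g) p]/(f p - g p).
have [/fg->|/negbTE p_even _] := boolP (odd (val p)); first by rewrite subrr eqxx.
apply: val_inj; case: (even_prime (valP p)) => // p_odd.
by rewrite p_odd in p_even.
Qed.

Lemma map_mpoly_eqP (A B : nzRingType) (f : {rmorphism A -> B}) N (P Q : {mpoly A[N]}) :
  map_mpoly f P = map_mpoly f Q <-> forall e, f P@_e = f Q@_e.
Proof.
split=> [fPQ e|fPQ]; first by rewrite -!mcoeff_map_mpoly fPQ.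
by apply/mpolyP => e; rewrite !mcoeff_map_mpoly; apply: fPQ.
Qed.

Lemma map_calA_proj_eq N (P Q : {mpoly prodFp[N]}) :
  (forall p : primeT, odd (val p) -> map_mpoly (prod_proj p) P = map_mpoly (prod_proj p) Q) ->
  map_mpoly calA_proj P = map_mpoly calA_proj Q.
Proof.
move=> PQ; apply/map_mpoly_eqP => e; apply: calA_proj_eq => p /PQ.
by move/map_mpoly_eqP/(_ e).
Qed.

Lemma calA_sums_eq s t n m :
  reversed_sum n m (@lam s t) (@mu s t) (fun a => (zetaA a)%:MP) =
  shuffle_sum n m (@lam s t) (@mu s t) (fun a => (zetaA a)%:MP).
Proof.
pose N := ((s + t) + (s + t))%N.
pose x l : {mpoly prodFp[N]} := 'X_(lshift (s + t) l).
pose y l : {mpoly prodFp[N]} := 'X_(rshift (s + t) l).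
pose z a : {mpoly prodFp[N]} := (zeta_p a : prodFp)%:MP.
have lamE : @lam s t = map_mpoly calA_proj \o x.
  by apply/funext => l; rewrite /= map_mpolyX.
have muE : @mu s t = map_mpoly calA_proj \o y.
  by apply/funext => l; rewrite /= map_mpolyX.
have zetaAE : (fun a => (zetaA a)%:MP) = map_mpoly calA_proj \o z.
  by apply/funext => a; rewrite /= map_mpolyC.
rewrite lamE muE zetaAE -rmorph_reversed_sum -rmorph_shuffle_sum.
apply: map_calA_proj_eq => p p_odd; rewrite rmorph_reversed_sum rmorph_shuffle_sum.
have -> : map_mpoly (prod_proj p) \o z = (fun a => (zeta_p a p)%:MP).
  by apply/funext => a; rewrite /= map_mpolyC.
exact: (@odd_prime_sums_eq p _ (@mpolyC N 'F_(val p)) s t n m).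
Qed.

Theorem theorem3p1 (n m s t : nat)
    (n_gt0 : (0 < n)%N) (m_gt0 : (0 < m)%N)
    (s_gt0 : (0 < s)%N) (t_gt0 : (0 < t)%N) :
  \sum_(r <- fset_set (Zset (s + t) n)) \sum_(k <- fset_set (Zset (s + t) m))
     (-1) ^+ q_exp r k
     * (\prod_(l < s + t) (lam l ^+ r l * mu l ^+ k l))
     * (\sum_(a <- fset_set (Sprod r k))
          (\prod_(u < t) sgn (a (rshift s u)))%:~R * zetaA (concat_rev a))%:MP
  =
  \sum_(sigma in Wset s t)
    \sum_(r <- fset_set (Zset (s + t) n)) \sum_(k <- fset_set (Zset (s + t) m))
     (\prod_(l < s + t)
        (Pform sigma (@lam s t) l ^+ r l * Pform sigma (@mu s t) l ^+ k l))
     * (\sum_(a <- fset_set (Sprod r k)) zetaA (concat a))%:MP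
  :> {mpoly calA[(s + t) + (s + t)]}.
Proof.
transitivity (reversed_sum n m (@lam s t) (@mu s t) (fun a => (zetaA a)%:MP)).
  apply: eq_bigr => r _; apply: eq_bigr => k _; congr (_ * _).
  by rewrite rmorph_sum; apply: eq_bigr => a _; rewrite rmorphM rmorph_int.
rewrite calA_sums_eq.
apply: eq_bigr => sigma _; apply: eq_bigr => r _; apply: eq_bigr => k _.
by rewrite rmorph_sum.
Qed.
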